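(* For every finite group $F$, there exists an orbit equivalence coupling from $F\wr\mathbb Z$ to $\mathbb Z$ which is $(\varphi_\varepsilon,\exp)$-integrable for every $\varepsilon>0$, where $\varphi_\varepsilon(x)=\dfrac{\log x}{(\log\log x)^{1+\varepsilon}}$.
   Context: Wreath product: $F\wr \mathbb Z=\left(\bigoplus_{\mathbb Z}F\right)\rtimes \mathbb Z$, with $\mathbb Z$ acting by shifting the coordinates. An orbit equivalence coupling from $\Gamma=\langle S_\Gamma\rangle$ to $\Lambda=\langle S_\Lambda\rangle$ ($S_\Gamma,S_\Lambda$ finite symmetric) is a standard probability space $(X,\mu)$ with free (up to null sets) measure-preserving actions of $\Gamma$ and $\Lambda$ such that $\Gamma\cdot x=\Lambda\cdot x$ for almost every $x\in X$. For $y\in\Lambda\cdot x$, $d_{S_\Lambda}(x,y)$ is the minimal word length of $\lambda\in\Lambda$ with $y=\lambda\cdot x$; $d_{S_\Gamma}$ is defined similarly. For non-decreasing $\varphi,\psi\colon[0,\infty)\to[0,\infty)$, the coupling is $(\varphi,\psi)$-integrable if for all $\gamma\in\Gamma$ and $\lambda\in\Lambda$ there are $c_\gamma,c_\lambda>0$ such that $$\int_X\varphi\left(\frac{d_{S_\Lambda}(x,\gamma\cdot x)}{c_\gamma}\right)d\mu(x)<\infty\quad\text{and}\quad\int_X\psi\left(\frac{d_{S_\Gamma}(x,\lambda\cdot x)}{c_\lambda}\right)d\mu(x)<\infty.$$ Integrability depends only on the behaviour of $\varphi,\psi$ at infinity; the formula for $\varphi_\varepsilon$ is meant for large $x$, and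 $\varphi_\varepsilon$ denotes any non-decreasing function $[0,\infty)\to[0,\infty)$ coinciding with it for large $x$. *)

(* Defs.v *)
(* MathComp / MathComp-Analysis *)
From HB Require Import structures.
From mathcomp Require Import all_boot all_order all_algebra all_fingroup finmap.
From mathcomp Require Import all_classical all_reals all_analysis.
Set Implicit Arguments.
Unset Strict Implicit.
Unset Printing Implicit Defensive.
Import Order.TTheory GRing.Theory Num.Theory.
Import numFieldNormedType.Exports.
Local Open Scope classical_set_scope.
Local Open Scope ring_scope.

Section Lamps.
Variable F : groupType.

Definition lamps := {fsfun int -> F with 1%g}.
Implicit Types f g h : lamps.

Definition lamps1 : lamps := [fsfun with 1%g].

Definition lamps_mul f g : lamps :=
  [fsfun i in (finsupp f `|` finsupp g)%fset => (f i * g i)%g].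

Definition lamps_inv f : lamps := [fsfun i in finsupp f => (f i)^-1%g].

Definition lamps_shift (t : int) f : lamps :=
  [fsfun i in [fset (j + t)%R | j in finsupp f]%fset => f (i - t)].

Lemma lamps1E i : lamps1 i = 1%g.
Proof. by rewrite /lamps1 fsfunE. Qed.

Lemma lamps_mulE f g i : lamps_mul f g i = (f i * g i)%g.
Proof.
rewrite /lamps_mul fsfunE in_fsetU; case: finsuppP => //= _.
by case: finsuppP => //= _; rewrite mulg1.
Qed.

Lemma lamps_invE f i : lamps_inv f i = (f i)^-1%g.
Proof. by rewrite /lamps_inv fsfunE; case: finsuppP => //; rewrite invg1. Qed.

Lemma lamps_shiftE t f i : lamps_shift t f i = f (i - t).
Proof.
rewrite /lamps_shift fsfunE; case: ifPn => // /negP nsupp.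
case: finsuppP => // supp; case: nsupp.
by apply/imfsetP; exists (i - t) => //=; rewrite subrK.
Qed.

End Lamps.

(* An element of F wr Z is a pair (f, m) with f in (+)_Z F and m in Z; the
   product is (f, m) (g, n) = (f (m . g), m + n), where (m . g) i = g (i - m) *)
Record wreathZ (F : groupType) :=
  WreathZ { wreath_lamps : lamps F; wreath_pos : int }.

Section WreathGroup.
Variable F : groupType.
Implicit Types u v w : wreathZ F.

Definition wreathZ_pair u := (wreath_lamps u, wreath_pos u).
Definition pair_wreathZ (p : lamps F * int) := WreathZ p.1 p.2.
Lemma wreathZ_pairK : cancel wreathZ_pair pair_wreathZ.
Proof. by case. Qed.

HB.instance Definition _ := Choice.copy (wreathZ F) (can_type wreathZ_pairK).

Definition wreathZ1 : wreathZ F := WreathZ (lamps1 F) 0.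

Definition wreathZ_mul u v : wreathZ F :=
  WreathZ
    (lamps_mul (wreath_lamps u) (lamps_shift (wreath_pos u) (wreath_lamps v)))
    (wreath_pos u + wreath_pos v).

Definition wreathZ_inv u : wreathZ F :=
  WreathZ (lamps_shift (- wreath_pos u) (lamps_inv (wreath_lamps u)))
    (- wreath_pos u).

Lemma wreathZ_eq u v : wreath_lamps u =1 wreath_lamps v ->
  wreath_pos u = wreath_pos v -> u = v.
Proof. by case: u v => [f m] [g n] /= /fsfunP -> ->. Qed.

Let wreathZE := (lamps_mulE, lamps_shiftE, lamps_invE, lamps1E).

Lemma wreathZ_mulA : associative wreathZ_mul.
Proof.
move=> u v w; apply: wreathZ_eq => [i|] /=; last by rewrite addrA.
by rewrite !wreathZE mulgA opprD addrA.
Qed.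

Lemma wreathZ_mul1 : left_id wreathZ1 wreathZ_mul.
Proof.
move=> u; apply: wreathZ_eq => [i|] /=; last by rewrite add0r.
by rewrite !wreathZE mul1g subr0.
Qed.

Lemma wreathZ_mulr1 : right_id wreathZ1 wreathZ_mul.
Proof.
move=> u; apply: wreathZ_eq => [i|] /=; last by rewrite addr0.
by rewrite !wreathZE mulg1.
Qed.

Lemma wreathZ_mulV : left_inverse wreathZ1 wreathZ_inv wreathZ_mul.
Proof.
move=> u; apply: wreathZ_eq => [i|] /=; last by rewrite addNr.
by rewrite !wreathZE mulVg.
Qed.

Lemma wreathZ_mulrV : right_inverse wreathZ1 wreathZ_inv wreathZ_mul.
Proof.
move=> u; apply: wreathZ_eq => [i|] /=; last by rewrite addrN.
by rewrite !wreathZE opprK subrK mulgV.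
Qed.

HB.instance Definition _ := isGroup.Build (wreathZ F)
  wreathZ_mulA wreathZ_mul1 wreathZ_mulr1 wreathZ_mulV wreathZ_mulrV.

End WreathGroup.

(* int is only an additive group in the library *)
Definition Zgroup : groupType := Algebra.to_multiplicative int.

Section WordMetric.
Variable G : groupType.

Definition is_word (S : seq G) (w : seq G) (g : G) :=
  {subset w <= S} /\ g = (\prod_(s <- w) s)%g.

Definition finite_symmetric_generating (S : seq G) :=
  (forall s, s \in S -> s^-1%g \in S) /\ forall g, exists w, is_word S w g.

(* junk value 0 on the empty set *)
Definition least (A : set nat) : nat :=
  xget 0%N [set n | A n /\ forall m, A m -> (n <= m)%N].

Definition word_length (S : seq G) (g : G) : nat :=
  least [set n | exists2 w, is_word S w g & size w = n].

(* junk value 0 when x and y lie in different orbits *)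
Definition orbit_dist (T : Type) (act : G -> T -> T) (S : seq G) (x y : T) :=
  least [set n | exists2 g, y = act g x & word_length S g = n].

End WordMetric.

(* measurable isomorphism with a Polish space and its Borel sigma-algebra *)
Definition standard_borel (R : realType) (d : measure_display)
    (T : measurableType d) :=
  exists (P : completePseudoMetricType R) (f : T -> P),
    [/\ hausdorff_space P,
        exists2 D : set P, countable D & dense D,
        bijective f &
        forall A : set T, measurable A <-> <<s @open P >> (f @` A)].

Section Coupling.
Variables (R : realType) (d : measure_display) (T : measurableType d).
Variable mu : probability T R.

Definition is_left_action (G : groupType) (act : G -> T -> T) :=
  (forall x, act 1%g x = x) /\
  (forall g h x, act (g * h)%g x = act g (act h x)).

Definition pmp_action (G : groupType) (act : G -> T -> T) :=
  [/\ is_left_action act,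
      forall g, measurable_fun setT (act g) &
      forall g A, measurable A -> mu (act g @^-1` A) = mu A].

Definition ae_free (G : groupType) (act : G -> T -> T) :=
  {ae mu, forall x, forall g, g <> 1%g -> act g x <> x}.

Definition orbit_of (G : groupType) (act : G -> T -> T) (x : T) : set T :=
  range (act ^~ x).

Definition oe_coupling (G L : groupType)
    (actG : G -> T -> T) (actL : L -> T -> T) :=
  [/\ standard_borel R T,
      pmp_action actG /\ ae_free actG,
      pmp_action actL /\ ae_free actL &
      {ae mu, forall x, orbit_of actG x = orbit_of actL x}].

Definition displacement_integrable (G L : groupType) (actG : G -> T -> T)
    (actL : L -> T -> T) (SL : seq L) (phi : R -> R) :=
  forall g : G, exists2 c : R, 0 < c &
    (\int[mu]_x (phi ((orbit_dist actL SL x (actG g x))%:R / c))%:E < +oo)%E.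

Definition coupling_integrable (G L : groupType) (actG : G -> T -> T)
    (actL : L -> T -> T) (SG : seq G) (SL : seq L) (phi psi : R -> R) :=
  displacement_integrable actG actL SL phi /\
  displacement_integrable actL actG SG psi.

End Coupling.

Definition log_profile (R : realType) (eps x : R) : R :=
  ln x / (ln (ln x)) `^ (1 + eps).

(* non-decreasing functions [0, +oo[ -> [0, +oo[; values at x < 0 are
   irrelevant *)
Definition nonneg_nondecreasing (R : realType) (phi : R -> R) :=
  (forall x, 0 <= x -> 0 <= phi x) /\
  (forall x y, 0 <= x -> x <= y -> phi x <= phi y).

(* Main.v *)
Require Import Defs.
From HB Require Import structures.
From mathcomp Require Import all_boot all_order all_algebra all_fingroup finmap.
From mathcomp Require Import all_classical all_reals all_analysis measurable_realfun.
From mathcomp Require Import zify ring lra.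
Set Implicit Arguments.
Unset Strict Implicit.
Unset Printing Implicit Defensive.
Import Order.TTheory GRing.Theory Num.Theory.
Import numFieldNormedType.Exports.
Local Open Scope classical_set_scope.
Local Open Scope ring_scope.

(* Both groups act on [0, 1[ with Lebesgue measure by cutting and translating.
   Use mixed-radix digits whose n-th place has |F|^(2^n) * 2 values: such a digit
   says whether the current block of 2^n sites is the left or the right half of a
   block of 2^(n+1) sites, and gives the state of the lamps of the other half.
   The first N digits then encode a position in a block of 2^N sites together
   with the lamps of that block, i.e. an element of a Folner tile of F wr Z, and
   also, read little-endian, an integer below Q_N = 2^N |F|^(2^N - 1).  F wr Z
   acts on the former, Z acts on the latter by the odometer, and almost surely
   either motion only changes finitely many digits; so both orbits of x consist
   of the points with the same tail of digits as x.

   A given element of F wr Z fails to act within the first N digits with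
   probability O(2^-N), and otherwise it moves x by at most Q_N = exp O(2^N)
   steps of Z: the profile is integrable since
   2^-N log Q_N / (log log Q_N)^(1+eps) = O(N^-(1+eps)).
   A given integer fails to act within the first N digits with probability
   O(1/Q_N), and otherwise it moves x by O(2^N) in F wr Z, which makes exp
   integrable as soon as |F| >= 2. *)

(** * Counters read from mixed-radix digits *)

Section MixedRadix.
Local Open Scope nat_scope.

Lemma sum_ord_mul (Q q : nat) (f : nat -> nat) :
  \sum_(k < Q * q) f k = \sum_(k < Q) \sum_(d < q) f (k * q + d).
Proof.
elim: Q => [|Q IH]; first by rewrite mul0n !big_ord0.
by rewrite mulSnr big_split_ord /= IH big_ord_recr.
Qed.

Definition place (r : nat -> nat) (N : nat) : nat := \prod_(i < N) r i.

Lemma placeS r N : place r N.+1 = place r N * r N.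
Proof. exact: big_ord_recr. Qed.

Lemma place0 r : place r 0 = 1. Proof. exact: big_ord0. Qed.

Lemma place_gt0 r N : (forall n, 0 < r n) -> 0 < place r N.
Proof. by move=> r0; exact: prodn_gt0. Qed.

Variables (q r : nat -> nat) (e : nat -> nat -> nat).

(* [k] is read in the big-endian mixed radix [q], so that [k %/ q n] drops its
   last digit, while the counter is little-endian in the radix [r]. *)
Fixpoint counter (N k : nat) : nat :=
  if N is n.+1 then counter n (k %/ q n) + e n (k %% q n) * place r n else 0.

(* the counter can move by [K] in both directions without a carry past the
   place [N] *)
Definition margin (K N k : nat) : bool :=
  (K <= counter N k) && (counter N k + K < place r N).

Hypothesis q0 : forall n, 0 < q n.

Lemma counterS N k d : d < q N ->
  counter N.+1 (k * q N + d) = counter N k + e N d * place r N.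
Proof. by move=> dq /=; rewrite divnMDl // modnMDl divn_small // modn_small // addn0. Qed.

Hypothesis elt : forall n d, d < q n -> e n d < r n.

Lemma counter_lt N k : counter N k < place r N.
Proof.
elim: N k => [|N IH] k /=; first by rewrite place0.
have := elt (ltn_pmod k (q0 N)); have := IH (k %/ q N); rewrite placeS.
by nia.
Qed.

(** The new digit adds a multiple of [place r N], so a range of values that avoids a carry below it
    still avoids one above. *)
Lemma marginS K N k : margin K N (k %/ q N) -> margin K N.+1 k.
Proof.
rewrite /margin /= placeS => /andP[h1 h2]; apply/andP; split; first by lia.
by have := elt (ltn_pmod k (q0 N)); nia.
Qed.

(** Among the digits below [q n], the map [e n] takes each value below [r n] equally often; the
    averages are cross-multiplied to avoid division. *)
Hypothesis balanced : forall n (h : nat -> nat),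
  (\sum_(d < q n) h (e n d)) * r n = q n * \sum_(i < r n) h i.

(** Equidistribution passes to the whole counter by induction: the last digit of [k] supplies the
    top place and is handled by [balanced], the other digits by the induction hypothesis. *)
Lemma counter_balanced N (h : nat -> nat) :
  (\sum_(k < place q N) h (counter N k)) * place r N =
  place q N * \sum_(j < place r N) h j.
Proof.
elim: N h => [|N IH] h; first by rewrite !place0 !big_ord1 muln1 mul1n.
rewrite !placeS (sum_ord_mul _ _ (fun k => h (counter N.+1 k))).
rewrite [X in X * _ = _](_ : _ = \sum_(d < q N) \sum_(k < place q N)
   h (counter N k + e N d * place r N)); last first.
  rewrite exchange_big; apply: eq_bigr => d _; apply: eq_bigr => k _.
  by rewrite counterS.
rewrite [place r N * r N]mulnC mulnA.
rewrite (balanced N (fun i => \sum_(k < place q N) h (counter N k + i * place r N))).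
rewrite -mulnA big_distrl /=.
under eq_bigr => i _ do rewrite (IH (fun j => h (j + i * place r N))).
rewrite -big_distrr /= (sum_ord_mul _ _ h) mulnCA mulnA.
by congr (_ * _); apply: eq_bigr => i _; apply: eq_bigr => j _; rewrite addnC.
Qed.

(** Only the [K] lowest and the [K] highest counter values fail, and the counter is
    equidistributed. *)
Lemma card_not_margin K N :
  (\sum_(k < place q N) ~~ margin K N k) * place r N <= place q N * (2 * K).
Proof.
pose h j := ~~ ((K <= j) && (j + K < place r N)) : nat.
rewrite (counter_balanced N h) leq_mul2l; apply/orP; right.
rewrite /h; move: (place r N) => M {h}.
apply: (@leq_trans (\sum_(j < M) (((j < K) : nat) + (M - K <= j)))).
  by apply: leq_sum => j _; lia.
rewrite big_split /= mul2n -addnn.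
have lt_sum : forall m, \sum_(j < m) (j < K) <= K.
  move=> m; suff -> : \sum_(j < m) (j < K) = minn m K by rewrite geq_minr.
  by elim: m => [|m IH]; [rewrite big_ord0 min0n | rewrite big_ord_recr /= IH; lia].
apply: leq_add; first exact: lt_sum.
(* Reversing the order turns the highest values into the lowest ones. *)
apply: leq_trans (lt_sum M); rewrite (reindex_inj rev_ord_inj) /=.
by apply: leq_sum => j _; have := ltn_ord j; lia.
Qed.

End MixedRadix.

(** * Digit cells of the unit interval and tails of digits *)

Section Cylinders.
Variables (R : realType) (q : nat -> nat).
Hypothesis q0 : forall n, (0 < q n)%N.
Implicit Types (x y : R) (N k l : nat).

Local Notation Q N := (place q N).

Definition unit_itv : set R := `[0, 1[%classic.

Definition cell N x : nat := Num.trunc (x * (Q N)%:R).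

(* [x] and [y] have the same position inside their cells of level [N], i.e. the
   same digits from the place [N] on *)
Definition tail N x y : Prop :=
  [/\ unit_itv x, unit_itv y &
      x * (Q N)%:R - (cell N x)%:R = y * (Q N)%:R - (cell N y)%:R].

Lemma unit_itvE x : unit_itv x <-> 0 <= x < 1.
Proof. by rewrite /unit_itv /= in_itv. Qed.

Let Q0 N : 0 < (Q N)%:R :> R.
Proof. by rewrite ltr0n place_gt0. Qed.

Lemma cellP N x k : 0 <= x ->
  (cell N x = k) <-> (k%:R <= x * (Q N)%:R < k%:R + 1).
Proof.
move=> x0; rewrite natr1; split => [<-|]; last exact: truncn_def.
by apply: truncn_itv; rewrite mulr_ge0.
Qed.

Lemma cell_lt N x : unit_itv x -> (cell N x < Q N)%N.
Proof.
move=> /unit_itvE /andP[x0 x1]; rewrite truncn_lt_nat ?mulr_ge0//.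
by rewrite gtr_pMl.
Qed.

Lemma cellS N x : unit_itv x -> (cell N.+1 x %/ q N)%N = cell N x.
Proof.
move=> /unit_itvE /andP[x0 _]; apply/esym/cellP => //.
have /andP[h1 h2] := (cellP N.+1 (cell N.+1 x) x0).1 erefl.
move: h1 h2; set P := cell _ _; rewrite placeS natrM mulrA => h1 h2.
have qR : 0 < (q N)%:R :> R by rewrite ltr0n.
have eP := divn_eq P (q N); have lm := ltn_pmod P (q0 N).
apply/andP; split.
  rewrite -(ler_pM2r qR) -natrM; apply: le_trans h1; rewrite ler_nat.
  exact: leq_trunc_div.
rewrite -(ltr_pM2r qR); apply: lt_le_trans h2 _.
rewrite !natr1 -natrM ler_nat [X in (X < _)%N]eP.
by rewrite mulSn addnC ltn_add2r.
Qed.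

Lemma tail_refl N x : unit_itv x -> tail N x x.
Proof. by split. Qed.

Lemma tail_sym N x y : tail N x y -> tail N y x.
Proof. by case. Qed.

Lemma tail_trans N x y z : tail N x y -> tail N y z -> tail N x z.
Proof. by move=> [? _ h1] [_ ? h2]; split => //; rewrite h1 h2. Qed.

Lemma tail_eq N x y : tail N x y -> cell N x = cell N y -> x = y.
Proof.
move=> [_ _ h] e; move: h; rewrite e => /addIr; apply: mulIf; exact: lt0r_neq0.
Qed.

Lemma tail_sub N x y : tail N x y ->
  y = x + ((cell N y)%:R - (cell N x)%:R) / (Q N)%:R.
Proof.
move=> [_ _ h]; apply: (mulIf (lt0r_neq0 (Q0 N))).
rewrite mulrDl divfK ?lt0r_neq0//; lra.
Qed.

Lemma tail_exists N x k : unit_itv x -> (k < Q N)%N ->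
  exists2 y, tail N x y & cell N y = k.
Proof.
move=> xI kQ; have /unit_itvE /andP[x0 x1] := xI.
have /andP[h1 h2] := (cellP N (cell N x) x0).1 erefl.
pose y := x + (k%:R - (cell N x)%:R) / (Q N)%:R.
have yE : y * (Q N)%:R = x * (Q N)%:R + (k%:R - (cell N x)%:R).
  by rewrite mulrDl divfK ?lt0r_neq0.
have k0 : 0 <= k%:R :> R by [].
have k1 : k%:R + 1 <= (Q N)%:R :> R by rewrite natr1 ler_nat.
have y0 : 0 <= y by rewrite -(pmulr_lge0 _ (Q0 N)) yE; lra.
have pk : cell N y = k by apply/cellP => //; rewrite yE; apply/andP; split; lra.
exists y => //; split => //; last by rewrite pk yE; lra.
by apply/unit_itvE; rewrite y0 -(ltr_pM2r (Q0 N)) yE; lra.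
Qed.

Lemma tailS N x y : tail N x y -> tail N.+1 x y /\
  (cell N.+1 x %% q N)%N = (cell N.+1 y %% q N)%N.
Proof.
move=> t; have [xI yI h] := t.
have := cellS N xI; have := cellS N yI.
have /unit_itvE /andP[x0 _] := xI; have /unit_itvE /andP[y0 _] := yI.
have /andP[] := (cellP N.+1 (cell N.+1 x) x0).1 erefl.
have /andP[] := (cellP N.+1 (cell N.+1 y) y0).1 erefl.
rewrite /tail; move: h.
set px := cell N x; set py := cell N y; set Px := cell N.+1 x.
set Py := cell N.+1 y => h; rewrite placeS natrM !mulrA => y1 y2 x1 x2 eqy eqx.
have [eX lX] := (divn_eq Px (q N), ltn_pmod Px (q0 N)).
have [eY lY] := (divn_eq Py (q N), ltn_pmod Py (q0 N)).
rewrite eqx in eX; rewrite eqy in eY.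
have eXR : Px%:R = px%:R * (q N)%:R + (Px %% q N)%:R :> R.
  by rewrite [in LHS]eX natrD natrM.
have eYR : Py%:R = py%:R * (q N)%:R + (Py %% q N)%:R :> R.
  by rewrite [in LHS]eY natrD natrM.
have hq : (x * (Q N)%:R - px%:R) * (q N)%:R = (y * (Q N)%:R - py%:R) * (q N)%:R.
  by rewrite h.
have eq_mod : (Px %% q N)%N = (Py %% q N)%N.
  (* The common offset scaled by [q N] has either digit as its integer part, so the two digits
     cannot differ. *)
  case: (ltngtP (Px %% q N) (Py %% q N)) => [||//] lt_mod.
    have := lt_mod; rewrite -(ler_nat R) -natr1 => ?; exfalso; lra.
  by have := lt_mod; rewrite -(ler_nat R) -natr1 => ?; exfalso; lra.
split=> //; split=> //; rewrite eXR eYR eq_mod; lra.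
Qed.

Lemma tail_mono N M x y : (N <= M)%N -> tail N x y -> tail M x y.
Proof.
by move=> /subnK <-; elim: (M - N)%N => // n IH /IH /tailS[].
Qed.

End Cylinders.

(** * Lebesgue measure on the unit interval as a standard probability space *)

Section UnitInterval.
Variable R : realType.
Local Open Scope ereal_scope.

Local Notation T := (measurableTypeR R).

Lemma measurable_unit_itv : measurable (@unit_itv R : set T).
Proof. exact: measurable_itv. Qed.

(** The underlying space is the whole real line and only the measure is restricted to [[0, 1[], so
    the standard Borel structure is that of the reals. *)
Definition unit_prob : set T -> \bar R :=
  mrestr (@lebesgue_measure R) measurable_unit_itv.

HB.instance Definition _ := Measure.on unit_prob.

Lemma unit_probT : unit_prob setT = 1.
Proof.
by rewrite /unit_prob /mrestr setTI lebesgue_measure_itv /= lte01 oppr0 addr0.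
Qed.

HB.instance Definition _ :=
  @Measure_isProbability.Build _ T R unit_prob unit_probT.

Lemma standard_borel_real : standard_borel R T.
Proof.
exists (R : completePseudoMetricType R), idfun; split.
- exact: norm_hausdorff.
- exists (range ratr); last exact: dense_rat.
  exact: sub_countable (card_image_le _ _) (countableP _).
- by exists idfun.
- move=> A; rewrite image_id; split.
    move=> mA; have : (@RGenOpens.G R).-sigma.-measurable A.
      by rewrite -RGenOpens.measurableE.
    move: A {mA}; apply: smallest_sub; first exact: smallest_sigma_algebra.
    by move=> B [x [y ->]]; apply: sub_sigma_algebra; exact: interval_open.
  apply: smallest_sub; first exact: sigma_algebra_measurable.
  by move=> B; exact: open_measurable.
Qed.

(** The pushforward by a translation agrees with Lebesgue measure on half-open intervals, which
    determine it. *)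
Lemma lebesgue_measure_translation (c : R) (A : set T) : measurable A ->
  lebesgue_measure [set x : T | A (x + c)%R] = lebesgue_measure A.
Proof.
move=> mA.
have mf : measurable_fun setT ((fun x => x + c)%R : T -> T).
  exact: measurable_funD (@measurable_id _ _ _) (measurable_cst _).
apply/esym; rewrite (_ : [set _ | _] = (fun x : T => x + c)%R @^-1` A)//.
apply: (lebesgue_measure_unique
  (mu := pushforward (@lebesgue_measure R) ((fun x => x + c)%R : T -> T))) => //.
move=> _ [[a b]] _ <- /=.
have preim : (fun x : T => x + c)%R @^-1` `]a, b]%classic =
    `](a - c)%R, (b - c)%R]%classic.
  by apply/seteqP; split => x /=; rewrite !in_itv /= ltrBlDr lerBrDr.
rewrite /pushforward preim !lebesgue_measure_itv /= !lte_fin ltrD2r.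
by rewrite -!EFinB (_ : b - c - (a - c) = b - a)%R //; ring.
Qed.

(** * Injective maps that move each point by a rational number *)

Section RationalDisplacement.
Variable s : T -> T.
Hypothesis s_inj : injective s.
Hypothesis s_rat : forall x, exists c : rat, s x = (x + ratr c)%R.
Hypothesis ms : forall c : rat, measurable [set x : T | s x = (x + ratr c)%R].

(** A countable partition of the line by the value of the displacement, the rationals being numbered
    by [pickle_inv]; indices that code no rational give empty pieces. *)
Let piece (n : nat) : set T :=
  if pickle_inv n is Some c then [set x | s x = (x + ratr (c : rat))%R] else set0.

Let measurable_piece n : measurable (piece n).
Proof. by rewrite /piece; case: pickle_inv. Qed.

Let piece_uniq m n x : piece m x -> piece n x -> m = n.
Proof.
have mK := @pickle_invK rat m; have nK := @pickle_invK rat n.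
rewrite /piece; move: mK nK; case: (pickle_inv m) => //= c <-.
case: (pickle_inv n) => //= c' <-.
by move=> -> /addrI /fmorph_inj ->.
Qed.

Let piece_cover x : exists n, piece n x.
Proof.
by have [c sx] := s_rat x; exists (choice.pickle c); rewrite /piece pickleK_inv.
Qed.

Let preim A n : set T := piece n `&` s @^-1` A.

Let preimE A : s @^-1` A = \bigcup_n preim A n.
Proof.
apply/seteqP; split => [x Ax|x [n _ []//]].
by have [n nx] := piece_cover x; exists n.
Qed.

Let translate_measurable c (A : set T) : measurable A ->
  measurable [set x : T | A (x + c)%R].
Proof.
have mf : measurable_fun setT ((fun x => x + c)%R : T -> T).
  by exact: measurable_funD (@measurable_id _ _ _) (measurable_cst _).
by move=> /(mf measurableT); rewrite setTI.
Qed.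

Let preim_measurable A n : measurable A -> measurable (preim A n).
Proof.
move=> mA; have := measurable_piece n; rewrite /preim /piece.
case: pickle_inv => [c mp|_]; last by rewrite set0I.
rewrite (_ : _ `&` _ = [set x | s x = (x + ratr c)%R] `&`
                       [set x | A (x + ratr c)%R]).
  by apply: measurableI => //; exact: translate_measurable.
by apply/seteqP; split => x [/= e]; rewrite /preimage /= e.
Qed.

Lemma measurable_rational_displacement : measurable_fun setT s.
Proof.
move=> _ A mA; rewrite setTI preimE; apply: bigcupT_measurable => n.
exact: preim_measurable.
Qed.

Let image_piece A n : measurable A -> measurable (s @` preim A n) /\
  lebesgue_measure (s @` preim A n) = lebesgue_measure (preim A n).
Proof.
move=> mA; have := preim_measurable n mA; rewrite /preim /piece.
case: pickle_inv => [c mp|_]; last by rewrite set0I image_set0.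
set B := _ `&` _ in mp *.
have -> : s @` B = [set y | B (y + (- ratr c))%R].
  apply/seteqP; split => [_ [x Bx <-]|y By] /=.
    by have [/= -> _] := Bx; rewrite addrK.
  by exists (y - ratr c)%R => //; have [/= -> _] := By; rewrite subrK.
by split; [exact: translate_measurable | exact: lebesgue_measure_translation].
Qed.

(** On each piece [s] is a translation and preserves measure; the images of the pieces of the
    preimage are disjoint subsets of [A]. *)
Lemma lebesgue_rational_displacement (A : set T) : measurable A ->
  lebesgue_measure (s @^-1` A) <= lebesgue_measure A.
Proof.
move=> mA; rewrite preimE measure_bigcup //=; last 2 first.
- by move=> i _; exact: preim_measurable.
- by move=> i j _ _ [x [[ix _] [jx _]]]; exact: piece_uniq ix jx.
under eq_eseriesr do rewrite -(image_piece _ mA).2.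
rewrite -(measure_bigcup _ setT (fun n => s @` preim A n)) //=; last 2 first.
- by move=> i _; exact: (image_piece _ mA).1.
- move=> i j _ _ [_ [[x [ix _] <-] [y [jy _] /s_inj yx]]].
  by apply: piece_uniq ix _; rewrite -yx.
apply: le_measure; rewrite ?inE //.
  by apply: bigcup_measurable => n _; exact: (image_piece _ mA).1.
by move=> _ [n _ [x [_ Ax] <-]].
Qed.

Hypothesis s_unit : forall x, unit_itv x -> unit_itv (s x).

(* Injectivity only makes the images of the pieces disjoint, hence the measure of
   a preimage can only decrease; applied to the complement, this gives equality. *)
Lemma unit_prob_rational_displacement (A : set T) : measurable A ->
  unit_prob (s @^-1` A) = unit_prob A.
Proof.
have le_preim B : measurable B -> unit_prob (s @^-1` B) <= unit_prob B.
  move=> mB; rewrite {2}/unit_prob /mrestr.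
  have mBI : measurable (B `&` (@unit_itv R : set T)).
    exact: measurableI mB measurable_unit_itv.
  apply: le_trans (lebesgue_rational_displacement mBI).
  rewrite /unit_prob /mrestr; apply: le_measure; rewrite ?inE.
  - apply: measurableI; last exact: measurable_unit_itv.
    by have := measurable_rational_displacement measurableT mB; rewrite setTI.
  - by have := measurable_rational_displacement measurableT mBI; rewrite setTI.
  - by move=> x [Bx /s_unit Ix]; split.
move=> mA; apply/eqP; rewrite eq_le le_preim //=.
have msA : measurable (s @^-1` A).
  by have := measurable_rational_displacement measurableT mA; rewrite setTI.
have := le_preim _ (measurableC mA); rewrite preimage_setC.
rewrite !probability_setC //.
rewrite -(fineK (fin_num_measure unit_prob _ mA)).
rewrite -(fineK (fin_num_measure unit_prob _ msA)) -!EFinB !lee_fin.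
by rewrite lerD2l lerN2 -lee_fin !fineK ?fin_num_measure.
Qed.

End RationalDisplacement.

End UnitInterval.

(** * Group actions defined level by level on digit cells *)

Section LevelAction.
Variables (R : realType) (q : nat -> nat).
Hypothesis q0 : forall n, (0 < q n)%N.

Local Notation T := (measurableTypeR R).
Local Notation Q := (place q).
Local Notation cell := (@cell R q).
Local Notation tail := (@tail R q).

Definition cylinder N k : set T :=
  `[(k%:R / (Q N)%:R : R), ((k%:R + 1) / (Q N)%:R)[%classic.

Let Q0 N : 0 < (Q N)%:R :> R.
Proof. by rewrite ltr0n place_gt0. Qed.

Lemma cylinderP N k (x : R) : 0 <= x -> cylinder N k x <-> cell N x = k.
Proof.
move=> x0; rewrite cellP // /cylinder /= in_itv /=.
by rewrite ler_pdivrMr // ltr_pdivlMr.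
Qed.

Lemma measurable_cylinder N k : measurable (cylinder N k).
Proof. exact: measurable_itv. Qed.

Lemma unit_prob_cylinder N k : (k < Q N)%N ->
  unit_prob (cylinder N k) = ((Q N)%:R^-1)%:E.
Proof.
move=> kQ; rewrite /unit_prob /mrestr.
have -> : cylinder N k `&` (@unit_itv R : set T) = cylinder N k.
  rewrite setIidl // /cylinder => x; rewrite /unit_itv /= !in_itv /=.
  move=> /andP[h1 h2]; apply/andP; split.
    by apply: le_trans h1; rewrite divr_ge0.
  apply: lt_le_trans h2 _; rewrite ler_pdivrMr // mul1r natr1 ler_nat.
  exact: kQ.
rewrite lebesgue_measure_itv /= lte_fin ltr_pM2r ?invr_gt0 // ltrDl ltr01.
by rewrite -EFinB mulrDl addrAC subrr add0r mul1r.
Qed.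

Definition level_set N (P : nat -> bool) : set T :=
  [set x : T | @unit_itv R x /\ P (cell N x)].

Lemma level_setE N P : level_set N P = \big[setU/set0]_(k < Q N | P k) cylinder N k.
Proof.
rewrite -bigcup_seq_cond; apply/seteqP; split => x.
  move=> [Ix Px]; have /unit_itvE /andP[x0 _] := Ix.
  exists (Ordinal (cell_lt q0 N Ix)) => /=; first by rewrite mem_index_enum.
  exact/cylinderP.
move=> [k /= /andP[_ Pk] xk].
have := xk; rewrite /cylinder /= in_itv /= => /andP[h1 h2].
have x0 : 0 <= x by apply: le_trans h1; rewrite divr_ge0.
split; last by move/(cylinderP _ _ x0): xk => ->.
apply/unit_itvE; rewrite x0; apply: lt_le_trans h2 _.
by rewrite ler_pdivrMr // mul1r natr1 ler_nat.
Qed.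

Lemma measurable_level_set N P : measurable (level_set N P).
Proof.
by rewrite level_setE; apply: bigsetU_measurable => i _; exact: measurable_cylinder.
Qed.

Lemma unit_prob_level_set N P :
  unit_prob (level_set N P) = ((\sum_(k < Q N) P k)%N%:R / (Q N)%:R)%:E.
Proof.
rewrite level_setE measure_bigsetU_ord_cond; last 2 first.
- by move=> k _; exact: measurable_cylinder.
- move=> i j _ _ [x [xi xj]].
  have := xi; rewrite /cylinder /= in_itv /= => /andP[h1 _].
  have x0 : 0 <= x by apply: le_trans h1; rewrite divr_ge0.
  move/(cylinderP _ _ x0): xi => xi; move/(cylinderP _ _ x0): xj => xj.
  by apply: val_inj => /=; rewrite -xi -xj.
rewrite big_mkcond natr_sum mulr_suml -sumEFin.
apply: eq_bigr => k _; case: (P k); last by rewrite mul0r.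
by rewrite mul1r; exact: unit_prob_cylinder.
Qed.

(** Read [rel N g k l] as: [g] carries cell [k] of level [N] to cell [l]. This action is only
    partial, since [g] may have to change digits beyond those of level [N]; [relS] makes the levels
    compatible. *)
Variables (G : groupType) (rel : nat -> G -> nat -> nat -> Prop).

Hypothesis relS : forall N g k l d, (d < q N)%N ->
  rel N g k l -> rel N.+1 g (k * q N + d) (l * q N + d).
Hypothesis rel_inj : forall N g k l l', (l < Q N)%N -> (l' < Q N)%N ->
  rel N g k l -> rel N g k l' -> l = l'.
Hypothesis rel1 : forall N k, rel N 1%g k k.
Hypothesis relM : forall N g h k l m,
  rel N h k l -> rel N g l m -> rel N (g * h)%g k m.
Hypothesis rel_free : forall N g k, rel N g k k -> g = 1%g.
Hypothesis rel_trans : forall N k l, (k < Q N)%N -> (l < Q N)%N ->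
  exists g, rel N g k l.

Variable good : set T.
Hypothesis good_unit : good `<=` (@unit_itv R : set T).
Hypothesis good_tail : forall N x y, tail N x y -> good x -> good y.
Hypothesis measurable_good : measurable good.
Hypothesis good_rel : forall x g, good x ->
  exists N l, (l < Q N)%N /\ rel N g (cell N x) l.

(** The image keeps the tail of [x] beyond some level and has the cell that [rel] prescribes there.
    Off [good] every element acts as the identity, so that the action laws hold at all points and
    not just almost everywhere. *)
Definition level_act (g : G) (x : T) : T :=
  if pselect (good x) is left _ then
    xget x [set y | exists N, tail N x y /\ rel N g (cell N x) (cell N y)]
  else x.

Lemma tail_rel N M g x y : (N <= M)%N -> tail N x y ->
  rel N g (cell N x) (cell N y) -> rel M g (cell M x) (cell M y).
Proof.
move=> /subnK <-; elim: (M - N)%N => // n IH t r.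
have {IH}r := IH t r; rewrite addSn; set L := (n + N)%N in r *.
have tL : tail L x y by apply: tail_mono t => //; rewrite leq_addl.
have [_ e] := tailS q0 tL; have [xI yI _] := tL.
rewrite (divn_eq (cell L.+1 x) (q L)) (divn_eq (cell L.+1 y) (q L)).
by rewrite !cellS // e; apply: relS => //; rewrite ltn_mod.
Qed.

(** The image does not depend on the level used: two candidates are compared at the larger of their
    levels, where [rel_inj] gives them the same cell and they share a tail. *)
Lemma level_actP N g x y : good x -> tail N x y ->
  rel N g (cell N x) (cell N y) -> level_act g x = y.
Proof.
move=> gx t r; rewrite /level_act; case: pselect => // _.
apply: xget_unique; first by exists N.
move=> z [M [tz rz]]; pose L := maxn N M.
have tL : tail L x y by apply: tail_mono t => //; exact: leq_maxl.
have tzL : tail L x z by apply: tail_mono tz => //; exact: leq_maxr.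
have rL : rel L g (cell L x) (cell L y) by apply: tail_rel r => //; exact: leq_maxl.
have rzL : rel L g (cell L x) (cell L z) by apply: tail_rel rz => //; exact: leq_maxr.
have tzy : tail L z y := tail_trans (tail_sym tzL) tL.
apply: (tail_eq q0 tzy); have [zI yI _] := tzy.
exact: rel_inj (cell_lt q0 L zI) (cell_lt q0 L yI) rzL rL.
Qed.

Lemma level_act_exists N g x l : good x -> (l < Q N)%N -> rel N g (cell N x) l ->
  tail N x (level_act g x) /\ cell N (level_act g x) = l.
Proof.
move=> gx lQ r; have [y t yl] := tail_exists q0 (good_unit gx) lQ.
by rewrite (level_actP gx t) ?yl.
Qed.

Lemma level_act_tail g x : good x -> exists N,
  tail N x (level_act g x) /\ rel N g (cell N x) (cell N (level_act g x)).
Proof.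
move=> gx; have [N [l [lQ r]]] := good_rel g gx.
by exists N; have [t ->] := level_act_exists gx lQ r.
Qed.

Lemma level_act_out g x : ~ good x -> level_act g x = x.
Proof. by rewrite /level_act; case: pselect. Qed.

Lemma good_level_act g x : good x -> good (level_act g x).
Proof. by move=> gx; have [N [t _]] := level_act_tail g gx; exact: good_tail t gx. Qed.

Lemma level_act_action : is_left_action level_act.
Proof.
split=> [x|g h x]; have [gx|ngx] := pselect (good x).
- by apply: (level_actP (N := 0) gx); [exact: tail_refl (good_unit gx) | exact: rel1].
- exact: level_act_out.
- have [N [t r]] := level_act_tail h gx.
  have [M [t' r']] := level_act_tail g (good_level_act h gx).
  pose L := maxn N M.
  apply: (level_actP (N := L) gx).
    by apply: tail_trans; [apply: tail_mono t => //; exact: leq_maxl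
      | apply: tail_mono t' => //; exact: leq_maxr].
  by apply: relM; [apply: tail_rel r => //; exact: leq_maxl
    | apply: tail_rel r' => //; exact: leq_maxr].
- by rewrite !level_act_out.
Qed.

(** The group does not occur on the right-hand side, so two such actions with the same [good] have
    the same orbits there. *)
Lemma level_act_orbit x : good x ->
  orbit_of level_act x = [set y | exists N, tail N x y].
Proof.
move=> gx; apply/seteqP; split => [_ [g _ <-]|y [N t]].
  by have [N [t _]] := level_act_tail g gx; exists N.
have [xI yI _] := t.
have [g r] := rel_trans (cell_lt q0 N xI) (cell_lt q0 N yI).
by exists g => //; exact: level_actP t r.
Qed.

Lemma level_act_free g x : good x -> level_act g x = x -> g = 1%g.
Proof.
move=> gx e; have [N [_]] := level_act_tail g gx.
by rewrite e => /rel_free.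
Qed.

Let disp N k l : rat := (l%:R - k%:R) / (Q N)%:R.

Let disp_act N g x : tail N x (level_act g x) ->
  level_act g x = x + ratr (disp N (cell N x) (cell N (level_act g x))).
Proof.
by move=> t; rewrite {1}(tail_sub q0 t) fmorph_div rmorphB /= !ratr_nat.
Qed.

Lemma level_act_rat g x : exists c : rat, level_act g x = x + ratr c.
Proof.
have [gx|ngx] := pselect (good x); last first.
  by exists 0; rewrite level_act_out // raddf0 addr0.
by have [N [t _]] := level_act_tail g gx; eexists; exact: disp_act t.
Qed.

(** Inside [good] the displacement is constant on each cylinder where [g] acts, and there are
    countably many triples of a level and two cells; outside [good] it is zero. *)
Lemma measurable_level_act_disp g (c : rat) :
  measurable [set x : T | level_act g x = x + ratr c].
Proof.
pose D := [set u : nat * nat * nat |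
  [/\ (u.2 < Q u.1.1)%N, rel u.1.1 g u.1.2 u.2 & disp u.1.1 u.1.2 u.2 = c]].
rewrite (_ : [set _ | _] =
   (good `&` \bigcup_(u in D) cylinder u.1.1 u.1.2) `|`
   ~` good `&` [set _ : T | c = 0]); last first.
  apply/seteqP; split => x.
    move=> /= e; have [gx|ngx] := pselect (good x); last first.
      right; split => //; move: e; rewrite level_act_out //.
      by move=> /esym/eqP; rewrite -subr_eq0 addrAC subrr add0r fmorph_eq0 => /eqP.
    left; split=> //; have [N [t r]] := level_act_tail g gx.
    have [xI yI _] := t; have /unit_itvE /andP[x0 _] := xI.
    exists (N, cell N x, cell N (level_act g x)) => /=; last exact/cylinderP.
    split => //=; first exact: cell_lt.
    by move: e; rewrite {1}(disp_act t) => /addrI /fmorph_inj.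
  move=> [[gx [[[N k] l] /= [/= lQ r <-]]]|[ngx /= ->]]; last first.
    by rewrite level_act_out // raddf0 addr0.
  have /unit_itvE /andP[x0 _] := good_unit gx.
  move=> /(cylinderP _ _ x0) kE; rewrite -kE in r *.
  have [t e] := level_act_exists gx lQ r.
  by rewrite {1}(disp_act t) e.
apply: measurableU.
  apply: measurableI => //; rewrite bigcup_mkcond.
  apply: countable_bigcupT_measurable => // u.
  by case: ifP => // _; exact: measurable_cylinder.
apply: measurableI; first exact: measurableC.
case: (eqVneq c 0) => [->|/eqP c0].
  by rewrite (_ : mkset _ = setT) //; apply/seteqP; split.
by rewrite (_ : mkset _ = set0) //; apply/seteqP; split.
Qed.

(** Each element acts injectively, having an inverse, and with rational displacements, so
    [unit_prob_rational_displacement] applies. *)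
Lemma level_act_pmp : pmp_action (@unit_prob R) level_act.
Proof.
have gT g x : unit_itv x -> unit_itv (level_act g x).
  have [gx|ngx] := pselect (good x); last by rewrite level_act_out.
  by move=> _; exact/good_unit/good_level_act.
have [a1 aM] := level_act_action.
have inj g : injective (level_act g).
  by move=> x y e; rewrite -[x]a1 -[y]a1 -(mulVg g) !aM e.
split; first exact: level_act_action.
  move=> g; apply: measurable_rational_displacement.
  - exact: level_act_rat.
  - exact: measurable_level_act_disp.
move=> g A mA; apply: unit_prob_rational_displacement => //.
- exact: level_act_rat.
- exact: measurable_level_act_disp.
- exact: gT.
Qed.

End LevelAction.

(** * Almost every point has room for every bounded motion of the counter *)

Section CounterOnReals.
Variables (R : realType) (q r : nat -> nat) (e : nat -> nat -> nat).
Hypothesis q0 : forall n, (0 < q n)%N.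
Hypothesis r2 : forall n, (1 < r n)%N.
Hypothesis elt : forall n d, (d < q n)%N -> (e n d < r n)%N.
Hypothesis balanced : forall n (h : nat -> nat),
  ((\sum_(d < q n) h (e n d)) * r n = q n * \sum_(i < r n) h i)%N.

Local Notation T := (measurableTypeR R).
Local Notation cell := (@cell R q).
Local Notation tail := (@tail R q).
Local Notation level_set := (@level_set R q).
Local Notation counter := (counter q r e).
Local Notation margin := (margin q r e).

Definition wandering : set T :=
  [set x | @unit_itv R x /\ forall K, exists N, margin K N (cell N x)].

Lemma margin_cellS K N (x : R) : unit_itv x ->
  margin K N (cell N x) -> margin K N.+1 (cell N.+1 x).
Proof. by move=> Ix; rewrite -(cellS q0 N Ix); exact: marginS. Qed.

Lemma margin_cell_mono K N M (x : R) : unit_itv x -> (N <= M)%N ->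
  margin K N (cell N x) -> margin K M (cell M x).
Proof.
move=> Ix /subnK <-; elim: (M - N)%N => // n IH /IH.
by rewrite addSn; exact: margin_cellS.
Qed.

(** Digits beyond level [N] are common to both points, so the difference of their counters does not
    change with the level; sums avoid truncated subtraction. *)
Lemma counter_tail N M x y : (N <= M)%N -> tail N x y ->
  (counter M (cell M y) + counter N (cell N x) =
   counter M (cell M x) + counter N (cell N y))%N.
Proof.
move=> /subnK <-; elim: (M - N)%N => [|n IH] t; first by rewrite addnC.
rewrite addSn; set L := (n + N)%N in IH *.
have tL : tail L x y by apply: tail_mono t => //; rewrite leq_addl.
have [_ eq_mod] := tailS q0 tL; have [xI yI _] := tL.
have := IH t; rewrite /= !cellS // eq_mod.
lia.
Qed.

Lemma wandering_tail N x y : tail N x y -> wandering x -> wandering y.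
Proof.
move=> t [Ix wx]; have [_ Iy _] := t; split=> // K.
(* At all levels from [N] on, the counters of [x] and [y] differ by less than [place r N], which the
   enlarged margin of [x] absorbs. *)
have [M mM] := wx (K + place r N)%N.
pose L := maxn N M; exists L.
have NL : (N <= L)%N by exact: leq_maxl.
have := margin_cell_mono Ix (leq_maxr N M : (M <= L)%N) mM.
have := counter_tail NL t.
have := counter_lt q0 elt N (cell N x); have := counter_lt q0 elt N (cell N y).
rewrite /margin; lia.
Qed.

Lemma measurable_wandering : measurable wandering.
Proof.
rewrite (_ : wandering = \bigcap_K \bigcup_N level_set N (margin K N)).
  apply: bigcapT_measurable => K; apply: bigcupT_measurable => N.
  exact: measurable_level_set.
apply/seteqP; split => x.
  by move=> [Ix wx] K _; have [N mN] := wx K; exists N.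
move=> wx; split; first by have [N _ []] := wx 0%N I.
by move=> K; have [N _ [_ mN]] := wx K I; exists N.
Qed.

Lemma unit_prob_not_margin K N :
  (unit_prob (level_set N (fun k => ~~ margin K N k) : set T) <=
   ((2 * K)%:R / (place r N)%:R)%:E)%E.
Proof.
have r0 n : (0 < r n)%N by exact: ltnW.
rewrite unit_prob_level_set // lee_fin.
rewrite ler_pdivrMr ?ltr0n ?place_gt0 // mulrAC ler_pdivlMr ?ltr0n ?place_gt0 //.
rewrite -!natrM ler_nat [leqRHS]mulnC.
exact: card_not_margin.
Qed.

Lemma ltn_place N : (N < place r N)%N.
Proof.
elim: N => [|N IH]; first by rewrite place0.
by rewrite placeS; have := r2 N; nia.
Qed.

(** For fixed [K], the points without margin at every level lie in sets of measure at most
    [2 * K / place r N], which tends to 0. *)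
Lemma wandering_conull : (@unit_prob R).-negligible (~` wandering).
Proof.
have sub : ~` wandering `<=` ~` (@unit_itv R : set T) `|`
    \bigcup_K \bigcap_N level_set N (fun k => ~~ margin K N k).
  move=> x nw; have [Ix|] := pselect (@unit_itv R x); [right|by left].
  apply: contrapT => nx; apply: nw; split => // K; apply: contrapT => nK.
  by apply: nx; exists K => // N _; split => //; apply/negP => mN; apply: nK; exists N.
apply: negligibleS sub _; apply: negligibleU.
  exists (~` (@unit_itv R : set T)); split => //.
    by apply: measurableC; exact: measurable_unit_itv.
  by rewrite /= /unit_prob /mrestr setICl measure0.
apply: negligible_bigcup => K.
have mB : measurable (\bigcap_N level_set N (fun k => ~~ margin K N k) : set T).
  by apply: bigcapT_measurable => N; exact: measurable_level_set.
exists (\bigcap_N level_set N (fun k => ~~ margin K N k) : set T); split => //.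
apply/eqP; rewrite eq_le measure_ge0 andbT; apply/lee_addgt0Pr => eps eps0.
(* With this level, [2 * K / eps < N < place r N]. *)
rewrite add0e; pose N := Num.bound ((2 * K)%:R / eps).
apply: (@le_trans _ _ (unit_prob (level_set N (fun k => ~~ margin K N k) : set T))).
  apply: le_measure; rewrite ?inE //; first exact: measurable_level_set.
  by move=> x /(_ N I).
apply: le_trans (unit_prob_not_margin K N) _; rewrite lee_fin.
have r0 n : (0 < r n)%N by exact: ltnW.
rewrite ler_pdivrMr ?ltr0n ?place_gt0 // mulrC -ler_pdivrMr //.
apply: (@le_trans _ _ N%:R); last by rewrite ler_nat ltnW // ltn_place.
by apply/ltW/archi_boundP; rewrite divr_ge0 // ltW.
Qed.

End CounterOnReals.

(** * Cells as tiles of the lamplighter group and as odometer positions *)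

Section LamplighterTiles.
Variable F : finGroupType.
Implicit Types (g h : wreathZ F) (N k l : nat) (i j : int).

(** The boolean is [true] when the current block becomes the right half; the function holds the
    lamps that the enlarged tile gains. *)
Definition block n : finType := (bool * {ffun 'I_(2 ^ n) -> F})%type.

Definition digits n : nat := #|block n|.

Lemma digitsE n : digits n = (2 * #|F| ^ (2 ^ n))%N.
Proof. by rewrite /digits card_prod card_bool card_ffun card_ord. Qed.

Lemma digits_gt1 n : (1 < digits n)%N.
Proof.
have F0 : (0 < #|F|)%N by apply/card_gt0P; exists 1%g.
by rewrite digitsE; have := expn_gt0 #|F| (2 ^ n); rewrite F0 /=; lia.
Qed.

Lemma digits_gt0 n : (0 < digits n)%N.
Proof. exact: ltnW (digits_gt1 n). Qed.

Definition decode n k : block n :=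
  nth (false, [ffun=> 1%g]) (enum {: block n}) k.

Definition encode n (b : block n) : nat := index b (enum {: block n}).

Lemma encode_lt n (b : block n) : (encode b < digits n)%N.
Proof. by rewrite /digits cardE index_mem mem_enum. Qed.

Lemma encodeK n (b : block n) : decode n (encode b) = b.
Proof. by rewrite /decode nth_index // mem_enum. Qed.

Lemma decode_inj n k l : (k < digits n)%N -> (l < digits n)%N ->
  decode n k = decode n l -> k = l.
Proof.
rewrite /digits cardE => kn ln /eqP; rewrite nth_uniq //; first by move/eqP.
exact: enum_uniq.
Qed.

Definition bit n k : nat := (decode n k).1.

(** The [2 ^ n] new lamps, numbered from 0 and off elsewhere. In a tile they start at site 0 if the
    old block is on the right, and at [2 ^ n - 1] if it is on the left, since the old block has no
    lamp at its last site. *)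
Definition ext n k (j : int) : F :=
  if j is Posz i then oapp (decode n k).2 1%g (insub i) else 1%g.

(* Tile [k] of level [N] has sites [0, 2^N[, and lamps at all of them but the
   last one, so that level 0 carries no information; the lamp is off outside. *)
Fixpoint lamp N k (j : int) : F :=
  if N is n.+1 then
    let d := (k %% digits n)%N in
    (lamp n (k %/ digits n) (j - (bit n d * 2 ^ n)%N%:Z) *
     ext n d (j - ((1 - bit n d) * (2 ^ n - 1))%N%:Z))%g
  else 1%g.

(** The site of the walker in its tile, with the choices of half as binary digits. *)
Definition pos := counter digits (fun=> 2) bit.

Definition rank := counter digits digits (fun _ d => d).

Lemma place2 N : place (fun=> 2%N) N = (2 ^ N)%N.
Proof. by rewrite /place prod_nat_const card_ord. Qed.

Lemma bit_lt2 n k : (bit n k < 2)%N. Proof. by rewrite /bit; case: (decode n k).1. Qed.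

(** Each of the two halves comes with the same number [#|F| ^ (2 ^ n)] of lamp states. *)
Lemma bit_balanced n (h : nat -> nat) :
  ((\sum_(d < digits n) h (bit n d)) * 2 = digits n * \sum_(i < 2) h i)%N.
Proof.
have -> : (\sum_(d < digits n) h (bit n d) = \sum_(b : block n) h b.1)%N.
  rewrite [RHS](reindex (@enum_val _ {: block n})) /=; last first.
    exact/onW_bij/enum_val_bij.
  apply: eq_bigr => d _; rewrite /bit /decode.
  by rewrite (enum_val_nth (false, [ffun=> 1%g])).
rewrite -(pair_bigA _ (fun (b : bool) (f : {ffun 'I_(2 ^ n) -> F}) => h b)) /=.
rewrite big_bool /= !sum_nat_const !big_ord_recl big_ord0 /= digitsE.
rewrite (_ : #|{ffun _}| = #|F| ^ (2 ^ n))%N; last by rewrite card_ffun card_ord.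
rewrite /bump /= !addn0 addnC; ring.
Qed.

Lemma rank_balanced n (h : nat -> nat) :
  ((\sum_(d < digits n) h d) * digits n = digits n * \sum_(i < digits n) h i)%N.
Proof. by rewrite mulnC. Qed.

Lemma pos_lt N k : (pos N k < 2 ^ N)%N.
Proof.
rewrite -place2; apply: counter_lt; first exact: digits_gt0.
by move=> n d _; exact: bit_lt2.
Qed.

Lemma posS N k d : (d < digits N)%N ->
  pos N.+1 (k * digits N + d) = (pos N k + bit N d * 2 ^ N)%N.
Proof. by move=> dq; rewrite /pos counterS ?place2 //; exact: digits_gt0. Qed.

Lemma rank_lt N k : (rank N k < place digits N)%N.
Proof. by apply: counter_lt => //; exact: digits_gt0. Qed.

Lemma rankS N k d : (d < digits N)%N ->
  rank N.+1 (k * digits N + d) = (rank N k + d * place digits N)%N.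
Proof. by move=> dq; rewrite /rank counterS //; exact: digits_gt0. Qed.

Lemma lampS N k d j : (d < digits N)%N ->
  lamp N.+1 (k * digits N + d) j =
  (lamp N k (j - (bit N d * 2 ^ N)%N%:Z) *
   ext N d (j - ((1 - bit N d) * (2 ^ N - 1))%N%:Z))%g.
Proof.
move=> dq /=; rewrite divnMDl ?digits_gt0 // modnMDl.
by rewrite divn_small // modn_small // addn0.
Qed.

Lemma ext_out n k j : ~~ (0 <= j < (2 ^ n)%N%:Z) -> ext n k j = 1%g.
Proof.
by case: j => // j; rewrite /ext lez_nat /= => nj; rewrite insubF //; apply/negbTE.
Qed.

Lemma lamp_out N k j : ~~ (0 <= j < (2 ^ N - 1)%N%:Z) -> lamp N k j = 1%g.
Proof.
elim: N k j => // N IH k j nj /=.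
have := bit_lt2 N (k %% digits N); set b := bit _ _ => b2.
have := expn_gt0 2 N; rewrite expnS in nj; move=> /= N0.
rewrite IH ?ext_out ?mulg1 //; nia.
Qed.

(** Together with [tile_inj], this identifies the cells of level [N] with the pairs of a site of the
    tile and a state of its [2 ^ N - 1] lamps. *)
Lemma tile_surj N p (W : int -> F) : (p < 2 ^ N)%N ->
  (forall j, W j != 1%g -> 0 <= j < (2 ^ N - 1)%N%:Z) ->
  exists k, [/\ (k < place digits N)%N, pos N k = p & lamp N k =1 W].
Proof.
elim: N p W => [|N IH] p W pN WN.
  exists 0%N; split; rewrite ?place0 //; first by case: p pN.
  move=> j; apply/esym/eqP; apply: contraT => /WN; rewrite expn0 subnn.
  by move=> /andP[j0 /(le_lt_trans j0)]; rewrite ltxx.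
(* The half containing [p] fixes the bit of the last digit; [W0] is [W] on the old block, in the
   coordinates of that block. *)
pose b : bool := (2 ^ N <= p)%N.
pose W0 (j : int) := if 0 <= j < (2 ^ N - 1)%N%:Z then W (j + (b * 2 ^ N)%N%:Z) else 1%g.
have [||k [kQ kp kW]] := IH (p - b * 2 ^ N)%N W0.
- by move: pN; rewrite expnS /b; case: leqP => /= *; lia.
- by move=> j; rewrite /W0; case: ifP => //; rewrite eqxx.
pose x : block N := (b, [ffun i : 'I_(2 ^ N) => W (i%:Z + ((1 - b) * (2 ^ N - 1))%N%:Z)]).
have dq := encode_lt x; exists (k * digits N + encode x)%N.
have bE : bit N (encode x) = b by rewrite /bit encodeK.
have extE j : ext N (encode x) j =
    if 0 <= j < (2 ^ N)%N%:Z then W (j + ((1 - b) * (2 ^ N - 1))%N%:Z) else 1%g.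
  case: ifPn => [|/ext_out->//]; case: j => // j /andP[_ jN].
  by rewrite /ext encodeK /= insubT /= ffunE.
split.
- by rewrite placeS; nia.
- rewrite posS // kp bE; move: pN; rewrite expnS /b; case: leqP => /= *; lia.
- move=> j; rewrite lampS // kW bE extE /W0 subrK subrK.
  have N0 := expn_gt0 2 N; have {}WN := WN j; rewrite expnS in WN.
  have W1 : ~~ (0 <= j < (2 * 2 ^ N - 1)%N%:Z) -> W j = 1%g.
    by move=> nj; apply/eqP; apply: contraNT nj => /WN.
  (* Old and new lamps occupy disjoint sites, which together are all the sites where [W] may be
     nontrivial. *)
  case: ifPn => h1; case: ifPn => h2; rewrite ?mulg1 ?mul1g //.
    by exfalso; move: h1 h2; have := leq_b1 b; nia.
  by rewrite W1 //; move: h1 h2; have := leq_b1 b; nia.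
Qed.

(** The position determines the half; then the lamps of the old block determine the earlier digits
    by induction, and the remaining lamps determine the last digit. *)
Lemma tile_inj N k l : (k < place digits N)%N -> (l < place digits N)%N ->
  pos N k = pos N l -> lamp N k =1 lamp N l -> k = l.
Proof.
elim: N k l => [|N IH] k l; first by rewrite place0; case: k; case: l.
rewrite placeS => kQ lQ.
rewrite (divn_eq k (digits N)) (divn_eq l (digits N)).
have dk := ltn_pmod k (digits_gt0 N); have dl := ltn_pmod l (digits_gt0 N).
rewrite !posS // => ep el.
have eb : bit N (k %% digits N) = bit N (l %% digits N).
  move: ep; have := pos_lt N (k %/ digits N); have := pos_lt N (l %/ digits N).
  have := bit_lt2 N (k %% digits N); have := bit_lt2 N (l %% digits N).
  by nia.
have := bit_lt2 N (l %% digits N); have N0 := expn_gt0 2 N.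
move: ep el; rewrite -eb; set b := bit _ _ in eb * => /eqP.
rewrite eqn_add2r => /eqP ep el b2.
have {}IH : (k %/ digits N = l %/ digits N)%N.
  apply: IH => //; try by rewrite ltn_divLR ?digits_gt0.
  move=> j; have [jN|jN] := boolP (0 <= j < (2 ^ N - 1)%N%:Z); last by rewrite !lamp_out.
  have := el (j + (b * 2 ^ N)%N%:Z); rewrite !lampS // -eb addrK.
  by rewrite !ext_out ?mulg1 //; nia.
rewrite IH; congr (_ + _)%N; apply: (@decode_inj N) => //.
move: (eb); rewrite {1}/b /bit; case E : (decode N (k %% digits N)) => [bk fk].
case E' : (decode N (l %% digits N)) => [bl fl] /= eb'.
congr (_, _); first by move: eb'; clear; case: bk; case: bl.
apply/ffunP => i; have := el (i%:Z + ((1 - b) * (2 ^ N - 1))%N%:Z).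
rewrite !lampS // -eb -/b addrK.
have iN := ltn_ord i.
rewrite !lamp_out ?mul1g; [|nia|nia].
by rewrite /ext E E' /= valK.
Qed.

Lemma rank_inj N k l : (k < place digits N)%N -> (l < place digits N)%N ->
  rank N k = rank N l -> k = l.
Proof.
elim: N k l => [|N IH] k l; first by rewrite place0; case: k; case: l.
rewrite placeS => kQ lQ.
rewrite (divn_eq k (digits N)) (divn_eq l (digits N)).
have dk := ltn_pmod k (digits_gt0 N); have dl := ltn_pmod l (digits_gt0 N).
have rk := rank_lt N (k %/ digits N); have rl := rank_lt N (l %/ digits N).
rewrite !rankS // => er.
have ed : (k %% digits N = l %% digits N)%N by nia.
rewrite ed; congr (_ * _ + _)%N; apply: IH; rewrite ?ltn_divLR ?digits_gt0 //.
by move: er; rewrite ed => /addIn.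
Qed.

Lemma rank_surj N p : (p < place digits N)%N ->
  exists2 k, (k < place digits N)%N & rank N k = p.
Proof.
elim: N p => [|N IH] p; first by rewrite place0; exists 0%N => //; case: p H.
rewrite placeS => pQ; have Q0 : (0 < place digits N)%N by exact/place_gt0/digits_gt0.
have [k kQ kp] := IH (p %% place digits N)%N (ltn_pmod _ Q0).
have dq : (p %/ place digits N < digits N)%N by rewrite ltn_divLR // mulnC.
exists (k * digits N + p %/ place digits N)%N; first by nia.
by rewrite rankS // kp addnC -divn_eq.
Qed.

End LamplighterTiles.

(** * Partial actions of both groups on the cells of a level *)

Section LevelRelations.
Variable F : finGroupType.
Implicit Types (g h : wreathZ F) (z : Zgroup) (N k l m : nat) (i j : int).

Local Notation pos := (@pos F).
Local Notation rank := (@rank F).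
Local Notation lamp := (@lamp F).
Local Notation Q := (place (digits F)).

(* [g] moves the lamplighter of tile [k] to that of tile [l]: the walker at
   site [pos N k] goes to [pos N l], and site [j] of the tile is seen from the
   walker at coordinate [pos N l - j]. *)
Definition wreath_rel N g k l : Prop :=
  (pos N l)%:Z = (pos N k)%:Z + wreath_pos g /\
  forall j, lamp N l j = (wreath_lamps g ((pos N l)%:Z - j) * lamp N k j)%g.

Definition int_rel N z k l : Prop := (rank N l)%:Z = (rank N k)%:Z + (z : int).

(** A common digit shifts the walkers and the old lamps by the same amount and adds the same new
    lamps, so coordinates seen from the walker do not change. *)
Lemma wreath_relS N g k l d : (d < digits F N)%N ->
  wreath_rel N g k l -> wreath_rel N.+1 g (k * digits F N + d) (l * digits F N + d).
Proof.
move=> dq [gp gl]; split; first by rewrite !posS // !PoszD gp addrAC.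
move=> j; rewrite !lampS // gl mulgA posS // PoszD.
by congr (wreath_lamps g _ * _ * _)%g; lia.
Qed.

Lemma wreath_rel_inj N g k l l' : (l < Q N)%N -> (l' < Q N)%N ->
  wreath_rel N g k l -> wreath_rel N g k l' -> l = l'.
Proof.
move=> lQ lQ' [p1 w1] [p2 w2].
have ep : pos N l = pos N l' by apply/eqP; rewrite -eqz_nat p1 p2.
by apply: (tile_inj lQ lQ' ep) => j; rewrite w1 w2 ep.
Qed.

Lemma wreath_rel1 N k : wreath_rel N 1%g k k.
Proof.
split; first by rewrite /= addr0.
by move=> j; rewrite [wreath_lamps _]/= lamps1E mul1g.
Qed.

(** At site [j], [h] is read at [pos N l - j], which equals [pos N m - j - wreath_pos g]: this is
    the shift in the wreath product. *)
Lemma wreath_relM N g h k l m :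
  wreath_rel N h k l -> wreath_rel N g l m -> wreath_rel N (g * h)%g k m.
Proof.
move=> [p1 w1] [p2 w2]; split.
  by rewrite p2 p1 [wreath_pos (g * h)%g]/= addrA addrAC.
move=> j; rewrite w2 w1 [wreath_lamps (g * h)%g]/= lamps_mulE lamps_shiftE mulgA.
by congr (_ * wreath_lamps h _ * _)%g; rewrite p2; lia.
Qed.

Lemma wreath_rel_free N g k : wreath_rel N g k k -> g = 1%g.
Proof.
move=> [p w]; apply: wreathZ_eq; last by move: p => /=; lia.
move=> i; rewrite [wreath_lamps 1%g]/= lamps1E.
have := w ((pos N k)%:Z - i); rewrite (_ : _ - (_ - i) = i); last by lia.
by rewrite -{1}[lamp _ _ _]mul1g => /mulIg.
Qed.

(** A crude size of [g] that controls both the margin it needs in a tile and its word length. *)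
Definition wreath_support (L : nat) g : Prop :=
  (`|wreath_pos g| <= L)%N /\ forall i, wreath_lamps g i != 1%g -> (`|i| <= L)%N.

Lemma wreath_rel_trans N k l : (k < Q N)%N -> (l < Q N)%N ->
  exists2 g, wreath_rel N g k l & wreath_support (2 ^ N) g.
Proof.
move=> kQ lQ; pose p := (pos N l)%:Z.
pose w i := (lamp N l (p - i) * (lamp N k (p - i))^-1)%g.
pose f : lamps F := [fsfun i in [fset (p - j%:Z)%R | j in iota 0 (2 ^ N)]%fset => w i].
have fE i : f i = w i.
  rewrite /f fsfunE; case: ifPn => // /negP ni.
  have out : ~~ (0 <= p - i < (2 ^ N - 1)%N%:Z).
    apply/negP => h; apply: ni; apply/imfsetP => /=; exists `|p - i|%N; last by lia.
    by rewrite mem_iota; lia.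
  by rewrite /w !lamp_out // invg1 mulg1.
have pl := pos_lt F N l; have pk := pos_lt F N k.
exists (WreathZ f (p - (pos N k)%:Z)).
  split=> /=; first by rewrite /p; lia.
  move=> j; rewrite fE /w /p (_ : _ - (_ - j) = j); last by lia.
  by rewrite mulgVK.
split=> /=; first by rewrite /p; lia.
move=> i; rewrite fE /w; apply: contraR => ni.
by rewrite !lamp_out ?invg1 ?mulg1 // /p; lia.
Qed.

Lemma wreath_support_exists g : exists L, wreath_support L g.
Proof.
pose B := (\sum_(i <- finsupp (wreath_lamps g)) `|i|)%N.
exists (`|wreath_pos g| + B)%N; split; first exact: leq_addr.
move=> i; rewrite -mem_finsupp => iS; apply: leq_trans (leq_addl _ _).
by rewrite /B (big_rem i) //= leq_addr.
Qed.

(** The walker moves by at most [L] and [g] changes lamps within [L] of its final site, hence within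
    [2 * L] of the initial one. One more site is needed because the last site of a tile has no
    lamp. *)
Lemma wreath_rel_exists N L g k : wreath_support L g ->
  margin (digits F) (fun=> 2%N) (@bit F) (2 * L).+1 N k ->
  exists l, (l < Q N)%N /\ wreath_rel N g k l.
Proof.
move=> [gp gl] /andP[]; rewrite place2 -/(pos N k) => m1 m2.
pose p := `|((pos N k)%:Z + wreath_pos g)%R|%N.
have pE : p%:Z = (pos N k)%:Z + wreath_pos g by rewrite /p; lia.
have [||l [lQ lp lW]] := @tile_surj F N p
  (fun j => wreath_lamps g (p%:Z - j) * lamp N k j)%g.
- lia.
- move=> j; apply: contraR => nj; rewrite lamp_out // mulg1.
  by apply: contraT => /gl; lia.
by exists l; split=> //; split; rewrite lp.
Qed.

Lemma int_relS N z k l d : (d < digits F N)%N ->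
  int_rel N z k l -> int_rel N.+1 z (k * digits F N + d) (l * digits F N + d).
Proof. by rewrite /int_rel => dq h; rewrite !rankS // !PoszD h addrAC. Qed.

Lemma int_rel_inj N z k l l' : (l < Q N)%N -> (l' < Q N)%N ->
  int_rel N z k l -> int_rel N z k l' -> l = l'.
Proof.
move=> lQ lQ' h1 h2; apply: rank_inj lQ lQ' _.
by apply/eqP; rewrite -eqz_nat h1 h2.
Qed.

Lemma int_rel1 N k : int_rel N 1%g k k.
Proof. exact/esym/addr0. Qed.

Lemma int_relM N (z y : Zgroup) k l m :
  int_rel N y k l -> int_rel N z l m -> int_rel N (z * y)%g k m.
Proof.
rewrite /int_rel => h1 h2; rewrite h2 h1.
by rewrite -addrA [y + z]addrC.
Qed.

Lemma int_rel_free N z k : int_rel N z k k -> z = 1%g.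
Proof. by rewrite /int_rel => h; apply: (@addrI _ (rank N k)%:Z); rewrite -h addr0. Qed.

Lemma int_rel_trans N k l : (k < Q N)%N -> (l < Q N)%N ->
  exists2 z, int_rel N z k l & (`|(z : int)| <= Q N)%N.
Proof.
move=> kQ lQ; exists ((rank N l)%:Z - (rank N k)%:Z).
  by rewrite /int_rel addrC subrK.
by have := rank_lt F N k; have := rank_lt F N l; lia.
Qed.

Lemma int_rel_exists N (L : nat) z k : (`|(z : int)| <= L)%N ->
  margin (digits F) (digits F) (fun _ d => d) L N k ->
  exists l, (l < Q N)%N /\ int_rel N z k l.
Proof.
move=> zL /andP[]; rewrite -/(rank N k) => m1 m2.
have [|l lQ lp] := @rank_surj F N `|((rank N k)%:Z + (z : int))%R|%N; first by lia.
by exists l; split=> //; rewrite /int_rel lp; lia.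
Qed.

End LevelRelations.

(** * Word lengths for arbitrary finite symmetric generating sets *)

Section WordLength.
Local Open Scope nat_scope.

Lemma least_spec (A : set nat) n : A n -> A (least A) /\ forall m, A m -> least A <= m.
Proof.
move=> An; suff : [set n | A n /\ forall m, A m -> n <= m] (least A) by [].
apply: xgetPex; have exA : exists m, `[< A m >] by exists n; apply/asboolP.
exists (ex_minn exA); case: ex_minnP => m /asboolP Am min; split=> // k Ak.
by apply: min; apply/asboolP.
Qed.

Lemma least_le (A : set nat) n : A n -> least A <= n.
Proof. by move=> An; have [_] := least_spec An; exact. Qed.

Variables (G : groupType) (S : seq G).

Lemma word_length_le w g : is_word S w g -> word_length S g <= size w.
Proof. by move=> wg; apply: least_le; exists w. Qed.

Lemma word_length1 : word_length S 1%g = 0.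
Proof.
apply/eqP; rewrite -leqn0; apply: (@word_length_le [::]).
by split=> //; rewrite big_nil.
Qed.

Lemma orbit_dist_le (T : Type) (act : G -> T -> T) x g :
  orbit_dist act S x (act g x) <= word_length S g.
Proof. by apply: least_le; exists g. Qed.

Hypothesis genS : finite_symmetric_generating S.

Lemma word_lengthP g : exists2 w, is_word S w g & size w = word_length S g.
Proof.
have [w wg] := genS.2 g.
by have [|] := @least_spec [set n | exists2 w, is_word S w g & size w = n] (size w);
  first by exists w.
Qed.

Lemma word_lengthM g h : word_length S (g * h)%g <= word_length S g + word_length S h.
Proof.
have [u [uS ->] <-] := word_lengthP g; have [v [vS ->] <-] := word_lengthP h.
rewrite -size_cat; apply: word_length_le; split; last by rewrite big_cat.
by move=> s; rewrite mem_cat => /orP[/uS|/vS].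
Qed.

End WordLength.

Lemma word_length_int (S : seq Zgroup) : finite_symmetric_generating S ->
  exists C, forall z : Zgroup, (word_length S z <= C * `|(z : int)|)%N.
Proof.
move=> genS; pose u : Zgroup := (1 : int); pose v : Zgroup := (- 1 : int).
exists (word_length S u + word_length S v)%N.
have posn (n : nat) : (word_length S (n%:Z : Zgroup) <= n * word_length S u)%N.
  elim: n => [|n IH].
    by rewrite (word_length1 S : word_length S (0%N%:Z : Zgroup) = 0%N).
  rewrite (_ : (n.+1%:Z : Zgroup) = (u * (n%:Z : Zgroup))%g); last first.
    by rewrite -[LHS]/(n.+1%:Z : int) intS.
  by apply: leq_trans (word_lengthM genS _ _) _; rewrite mulSn leq_add2l.
have negn (n : nat) : (word_length S (- n%:Z : Zgroup) <= n * word_length S v)%N.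
  elim: n => [|n IH].
    by rewrite (word_length1 S : word_length S (- 0%N%:Z : Zgroup) = 0%N).
  rewrite (_ : (- n.+1%:Z : Zgroup) = (v * (- n%:Z : Zgroup))%g); last first.
    by rewrite -[LHS]/(- n.+1%:Z : int) intS opprD.
  by apply: leq_trans (word_lengthM genS _ _) _; rewrite mulSn leq_add2l.
move=> z; case: (@ltP _ _ 0 (z : int)) => z0.
  have -> : z = (`|(z : int)|%N%:Z : Zgroup) by lia.
  by apply: leq_trans (posn _) _; rewrite mulnC leq_mul // leq_addr.
have -> : z = (- `|(z : int)|%N%:Z : Zgroup) by lia.
by apply: leq_trans (negn _) _; rewrite abszN absz_nat mulnC leq_mul // leq_addl.
Qed.

(** * Linear bounds on word length in the lamplighter group *)

Section WreathWordLength.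
Variable F : finGroupType.

Definition walk (z : int) : wreathZ F := WreathZ (lamps1 F) z.

Definition light (u : F) : wreathZ F :=
  WreathZ [fsfun i in [fset 0%R]%fset => u : F] 0.

Lemma wreath_lampsM (g h : wreathZ F) i : wreath_lamps (g * h)%g i =
  (wreath_lamps g i * wreath_lamps h (i - wreath_pos g))%g.
Proof. by rewrite [wreath_lamps (g * h)%g]/= lamps_mulE lamps_shiftE. Qed.

Lemma walkD y z : walk (y + z) = (walk y * walk z)%g.
Proof. by apply: wreathZ_eq => // i; rewrite wreath_lampsM /= !lamps1E mulg1. Qed.

Lemma lightE u i : wreath_lamps (light u) i = if i == 0 then u else 1%g.
Proof. by rewrite /= fsfunE inE. Qed.

Variable S : seq (wreathZ F).
Hypothesis genS : finite_symmetric_generating S.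

Variable C : nat.
Hypothesis walk_le : (word_length S (walk 1) <= C)%N.
Hypothesis walkN_le : (word_length S (walk (-1)) <= C)%N.
Hypothesis light_le : forall u, (word_length S (light u) <= C)%N.

Lemma word_length_walk z : (word_length S (walk z) <= C * `|z|)%N.
Proof.
have step (e : int) n : (word_length S (walk (e *+ n)) <= n * word_length S (walk e))%N.
  elim: n => [|n IH].
    by rewrite mulr0n (word_length1 S : word_length S (walk 0) = 0%N).
  rewrite mulrS walkD mulSn; apply: leq_trans (word_lengthM genS _ _) _.
  by rewrite leq_add2l.
case: (@ltP _ _ 0 z) => z0.
  have -> : z = 1 *+ `|z| by rewrite pmulrn; lia.
  by apply: leq_trans (step _ _) _; rewrite pmulrn intz absz_nat mulnC leq_mul.
have -> : z = (-1) *+ `|z| by rewrite mulNrn pmulrn; lia.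
by apply: leq_trans (step _ _) _; rewrite mulNrn pmulrn intz abszN absz_nat mulnC leq_mul.
Qed.

(** The walker sets the lamp at its site and then steps right, at a cost of at most [2 * C] per
    site. *)
Lemma sweep (f : int -> F) (n : nat) : exists p : wreathZ F,
  [/\ wreath_pos p = n%:Z,
      forall i, wreath_lamps p i = if 0 <= i < n%:Z then f i else 1%g &
      (word_length S p <= 2 * n * C)%N].
Proof.
elim: n => [|n [p [pp pl pw]]].
  exists 1%g; split=> //; last by rewrite word_length1.
  by move=> i; rewrite [wreath_lamps _]/= lamps1E; case: ifP => //; lia.
exists (p * (light (f n%:Z) * walk 1))%g; split.
- by rewrite [LHS]/= pp; lia.
- move=> i; rewrite !wreath_lampsM pl pp lightE [wreath_lamps (walk 1)]/= lamps1E mulg1.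
  have [->|ne] := eqVneq i n%:Z; first by rewrite subrr eqxx ifF ?ifT ?mul1g //; lia.
  rewrite subr_eq0 (negbTE ne) mulg1.
  by rewrite (_ : (0 <= i < n%:Z) = (0 <= i < n.+1%:Z)) //; lia.
- apply: leq_trans (word_lengthM genS _ _) _.
  apply: leq_trans (leq_add pw (leq_trans (word_lengthM genS _ _)
    (leq_add (light_le _) walk_le))) _.
  by rewrite mulnS mulnDl; lia.
Qed.

Lemma word_length_support L g : (0 < L)%N -> wreath_support L g ->
  (word_length S g <= 10 * C * L)%N.
Proof.
move=> L0 [gp gl].
(* Walk to [- L], sweep the [2 * L + 1] sites up to [L], then go from [L + 1] to [wreath_pos g]. *)
have [p [pp pl pw]] := sweep (fun i => wreath_lamps g (i - L%:Z)) (2 * L + 1)%N.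
have -> : g = (walk (- L%:Z) * (p * walk (wreath_pos g - L%:Z - 1)))%g.
  apply: wreathZ_eq => [i|]; last by rewrite [RHS]/= pp; lia.
  rewrite !wreath_lampsM /= !lamps1E mul1g mulg1 pl.
  case: ifPn => h; first by congr (wreath_lamps g _); lia.
  by apply/eqP; apply: contraNT h => /gl; lia.
(* The cost is at most [C] times [L + 2 * (2 * L + 1) + (2 * L + 1) = 7 * L + 3], which is at most
   [10 * L] as [L > 0]. *)
apply: leq_trans (word_lengthM genS _ _) _.
apply: leq_trans (leq_add (word_length_walk _) (leq_trans (word_lengthM genS _ _)
  (leq_add pw (word_length_walk _)))) _.
have : (`|(wreath_pos g - L%:Z - 1)%R| <= 2 * L + 1)%N by lia.
rewrite abszN absz_nat; move: (`|(_ - _ - 1)%R|)%N => a aL.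
have : (C * a <= C * (2 * L + 1))%N by rewrite leq_mul2l aL orbT.
have : (C * 1 <= C * L)%N by rewrite leq_mul2l L0 orbT.
clear; lia.
Qed.

End WreathWordLength.

(** Since [F] is finite, summing over it gives one bound for the lengths of all single-lamp
    elements. *)
Lemma word_length_wreath (F : finGroupType) (S : seq (wreathZ F)) :
  finite_symmetric_generating S ->
  exists C, forall L g, (0 < L)%N -> wreath_support L g ->
    (word_length S g <= C * L)%N.
Proof.
move=> genS; pose w := (\sum_(u : F) word_length S (light u))%N.
pose v := (word_length S (walk F 1) + word_length S (walk F (-1)))%N.
exists (10 * (v + w))%N => L g; apply: word_length_support => //.
- by rewrite /v -addnA leq_addr.
- by rewrite /v addnAC leq_addl.
- by move=> u; rewrite /w (bigD1 u) //= addnCA leq_addr.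
Qed.

(** * Integrals bounded layer by layer *)

Section LayeredIntegral.
Context d (T : measurableType d) (R : realType) (mu : probability T R).
Local Open Scope ereal_scope.

(* no measurability of [f] is needed: the integral is a supremum over simple
   functions *)
Lemma ge0_le_integral_nonmeas (f g : T -> \bar R) :
  (forall x, 0 <= f x) -> (forall x, f x <= g x) ->
  \int[mu]_x f x <= \int[mu]_x g x.
Proof.
move=> f0 fg.
have g0 x : 0 <= g x by exact: le_trans (f0 x) (fg x).
rewrite !ge0_integralTE //; apply: le_ereal_sup => _ [h hf <-].
by exists h => // x; exact: le_trans (hf x) (fg x).
Qed.

(** A point is charged [B n.+1] only if it lies in [M n], so [h] is at most [B 0] plus the series of
    [B n.+1] times the indicator of [M n]. Integrating termwise bounds the integral by [B 0 + K]. *)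
Lemma integral_layers (h : T -> R) (B p : nat -> R) (M : nat -> set T) (K : R) :
  (forall n, measurable (M n)) -> (forall n, 0 <= B n)%R -> (forall x, 0 <= h x)%R ->
  (forall n, mu (M n) <= (p n)%:E) ->
  (forall x, exists2 N, (h x <= B N)%R & forall n, (n < N)%N -> M n x) ->
  (forall n, \sum_(i < n) B i.+1 * p i <= K)%R ->
  \int[mu]_x (h x)%:E < +oo.
Proof.
move=> mM B0 h0 pM hB sumK.
pose f n (x : T) : \bar R := (B n.+1)%:E * (\1_(M n) x)%:E.
have f0 n x : 0 <= f n x by rewrite mule_ge0 // lee_fin.
have mf n : measurable_fun setT (f n).
  by apply: measurable_funeM; apply/measurable_EFinP; exact: measurable_indic.
have int_f n : \int[mu]_x f n x = (B n.+1)%:E * mu (M n).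
  rewrite ge0_integralZl //; last 2 first.
  - by apply/measurable_EFinP; exact: measurable_indic.
  - by rewrite lee_fin.
  by rewrite integral_indic // setIT.
pose g x := (B 0%N)%:E + \sum_(0 <= n <oo) f n x.
apply: (@le_lt_trans _ _ (\int[mu]_x g x)).
  apply: ge0_le_integral_nonmeas => x; first by rewrite lee_fin.
  have [[|N] hN MN] := hB x.
    apply: (@le_trans _ _ (B 0%N)%:E); rewrite ?lee_fin //.
    by rewrite leeDl // nneseries_ge0.
  apply: (@le_trans _ _ (f N x)).
    by rewrite /f indicE mem_set ?mule1 ?lee_fin //; exact: MN.
  apply: (@le_trans _ _ (\sum_(0 <= n <oo) f n x)); last first.
    by rewrite leeDr // lee_fin.
  apply: le_trans (nneseries_lim_ge N.+1 _); last by move=> n _ _; exact: f0.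
  by rewrite big_nat_recr //= leeDr // sume_ge0.
rewrite /g ge0_integralD //; last 3 first.
- by move=> x _; rewrite lee_fin.
- by move=> x _; rewrite nneseries_ge0.
- by apply: ge0_emeasurable_sum => //; move=> n x _ _; exact: f0.
rewrite integral_cst //.
rewrite [X in _ * X + _](_ : _ = 1); last exact: probability_setT.
rewrite mule1 integral_nneseries //.
apply: (@le_lt_trans _ _ (B 0%N + K)%:E); last exact: ltry.
rewrite EFinD leeD2l //; apply: lime_le.
  by apply: is_cvg_nneseries => n _ _; rewrite int_f mule_ge0 // lee_fin.
near=> n; rewrite big_mkord.
apply: (@le_trans _ _ (\sum_(i < n) (B i.+1 * p i)%:E)).
  by apply: lee_sum => i _; rewrite int_f EFinM lee_wpmul2l // lee_fin.
by rewrite sumEFin lee_fin.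
Unshelve. all: by end_near. Qed.

End LayeredIntegral.

(** * Series with bounded partial sums *)

Section BoundedSums.
Variable R : realType.
Implicit Types u w : nat -> R.

Definition bounded_sums u := exists K, forall n, \sum_(i < n) u i <= K.

Lemma bounded_sums_le u w N C : (forall i, 0 <= w i) -> 0 <= C ->
  (forall i, (N <= i)%N -> u i <= C * w i) -> bounded_sums w -> bounded_sums u.
Proof.
move=> w0 C0 uw [K wK].
exists (\sum_(i < N) `|u i| + C * K) => n.
have uw' i : u i <= (if (i < N)%N then `|u i| else 0) + C * w i.
  case: ltnP => iN; last by rewrite add0r uw.
  by apply: le_trans (ler_norm _) _; rewrite lerDl mulr_ge0.
apply: (le_trans (ler_sum _ (fun (i : 'I_n) _ => uw' i))).
rewrite big_split /= -mulr_sumr lerD ?ler_wpM2l ?wK //.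
rewrite -!(big_mkord xpredT (fun i => if (i < N)%N then `|u i| else 0)).
rewrite -(big_mkord xpredT (fun i => `|u i|)).
have pos m m' : 0 <= \sum_(m <= i < m') (if (i < N)%N then `|u i| else 0).
  by apply: sumr_ge0 => i _; case: ifP.
have -> : \sum_(0 <= i < N) `|u i| =
    \sum_(0 <= i < N) (if (i < N)%N then `|u i| else 0).
  by apply: eq_big_nat => i /andP[_ ->].
set G := BIG_F.
case: (leqP n N) => nN.
  have -> : \sum_(0 <= i < N) G i = \sum_(0 <= i < n) G i + \sum_(n <= i < N) G i.
    by rewrite -big_cat_nat.
  by rewrite lerDl.
have -> : \sum_(0 <= i < n) G i = \sum_(0 <= i < N) G i + \sum_(N <= i < n) G i.
  by rewrite -big_cat_nat // ltnW.
rewrite gerDl big_nat big1 // => i /andP[Ni _].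
by rewrite /G ltnNge Ni.
Qed.

Lemma bounded_sums_geometric : bounded_sums (fun i => (2 ^+ i)^-1).
Proof.
exists 2 => n; suff -> : \sum_(i < n) ((2 : R) ^+ i)^-1 = 2 - 2 * (2 ^+ n)^-1.
  by rewrite gerBl mulr_ge0 // invr_ge0 exprn_ge0.
elim: n => [|n IH]; first by rewrite big_ord0 expr0 invr1 mulr1 subrr.
rewrite big_ord_recr /= IH exprS invfM mulrA mulfV // mul1r.
by lra.
Qed.

Lemma bounded_sums_riemann (eps : R) : 0 < eps ->
  bounded_sums (fun i => (i.+1%:R `^ (1 + eps))^-1).
Proof.
move=> e0; pose v (i : nat) : R := (i.+1%:R `^ eps)^-1.
have v0 i : 0 <= v i by rewrite invr_ge0 powR_ge0.
(* x^-eps is convex and decreasing, hence the increments of -x^-eps/eps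
   dominate x^-(1+eps) *)
have tele i : (i.+2%:R `^ (1 + eps))^-1 <= eps^-1 * (v i - v i.+1).
  have i1 : 0 < i.+1%:R :> R by rewrite ltr0n.
  have i2 : 0 < i.+2%:R :> R by rewrite ltr0n.
  have vE : v i = v i.+1 * expR (eps * (ln i.+2%:R - ln i.+1%:R)).
    rewrite /v /powR !gt_eqF // -!expRN -expRD; congr expR; lra.
  have lnge : i.+2%:R^-1 <= ln (i.+2%:R) - ln (i.+1%:R) :> R.
    have : ln (1 + (- i.+2%:R^-1)) <= - i.+2%:R^-1 :> R.
      by apply: le_ln1Dx; rewrite ltrN2 invf_lt1 // ltr1n.
    rewrite (_ : 1 + _ = i.+1%:R / i.+2%:R); last first.
      by rewrite -{1}(mulfV (lt0r_neq0 i2)) -mulN1r -mulrDl -{1}natr1 addrK.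
    by rewrite ln_div ?posrE // lerNr opprB.
  have ege := expR_ge1Dx (eps * (ln i.+2%:R - ln i.+1%:R)).
  rewrite powRD ?(gt_eqF i2) ?implybT // powRr1 ?ler0n // invfM -/(v i.+1).
  rewrite ler_pdivlMl // vE.
  have : v i.+1 * (1 + eps * (ln i.+2%:R - ln i.+1%:R)) <=
         v i.+1 * expR (eps * (ln i.+2%:R - ln i.+1%:R)) by rewrite ler_wpM2l.
  have : v i.+1 * (eps * i.+2%:R^-1) <= v i.+1 * (eps * (ln i.+2%:R - ln i.+1%:R)).
    by rewrite ler_wpM2l // ler_pM2l.
  move: (expR (eps * _)) => E; move: (ln _ - ln _) (v i.+1) => l V.
  by move: (i.+2%:R^-1) => a h1 h2; clear -h1 h2; lra.
exists (1 + eps^-1) => -[|n].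
  by rewrite big_ord0 addr_ge0 // invr_ge0 ltW.
rewrite big_ord_recl /= powR1 invr1 lerD2l.
apply: (@le_trans _ _ (eps^-1 * (v 0%N - v n))); last first.
  by rewrite /v powR1 invr1 ger_pMr ?invr_gt0 // gerBl v0.
elim: n => [|n IH]; first by rewrite big_ord0 subrr mulr0.
rewrite big_ord_recr /=; have := lerD IH (tele n).
by rewrite /bump /= add1n -mulrDr addrA subrK.
Qed.

End BoundedSums.

(** * Size of the tiles and the two resulting series *)

Section Growth.
Variables (R : realType) (F : finGroupType).

Local Notation Q := (place (digits F)).

Let F0 : (0 < #|F|)%N. Proof. by apply/card_gt0P; exists 1%g. Qed.

Lemma place_digits_le N : (Q N <= (2 * #|F|) ^ (2 ^ N))%N.
Proof.
elim: N => [|N IH]; first by rewrite place0; move: F0; lia.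
rewrite placeS digitsE expnS [(2 * 2 ^ N)%N]mul2n -addnn expnD leq_mul //.
rewrite expnMn leq_mul //.
by rewrite -{1}(expn1 2) leq_exp2l // expn_gt0.
Qed.

(** The factor [2 ^ N], due to the positions, is what makes the series of [exp_profile_sums]
    geometric once [2 ^ (2 ^ N)] cancels. *)
Lemma place_digits_ge N : (1 < #|F|)%N -> (2 ^ N * 2 ^ (2 ^ N) <= Q N * 2)%N.
Proof.
move=> F1; elim: N => [|N IH]; first by rewrite place0.
rewrite placeS digitsE expnS.
rewrite [(2 ^ (2 * 2 ^ N))%N](_ : _ = 2 ^ 2 ^ N * 2 ^ 2 ^ N)%N; last first.
  by rewrite mul2n -addnn expnD.
have h : (2 ^ 2 ^ N <= #|F| ^ 2 ^ N)%N by rewrite leq_exp2r // expn_gt0.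
by have := leq_mul IH h; lia.
Qed.

Lemma place_digits_expR N : (Q N)%:R <= expR ((2 * #|F|)%:R * 2 ^+ N) :> R.
Proof.
apply: (@le_trans _ _ ((2 * #|F|) ^ (2 ^ N))%N%:R).
  by rewrite ler_nat place_digits_le.
rewrite [expR _](_ : _ = expR (2 * #|F|)%:R ^+ (2 ^ N)); last first.
  by rewrite mulrC -natrX expRM_natl.
rewrite natrX; apply: lerXn2r; rewrite ?nnegrE ?expR_ge0 //.
by apply: le_trans (expR_ge1Dx _); rewrite lerDr.
Qed.

(** Write [al = 2 * #|F|] and [y = al * 2 ^+ i.+1], so that [Q i.+1 <= expR y]. The profile at
    [expR y] is [y / ln y ^ (1 + eps)] with [ln y >= i.+1 * ln 2]; multiplied by [K / 2 ^+ i], it is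
    dominated by a constant times the Riemann term. *)
Lemma log_profile_sums (eps : R) (phi : R -> R) (K : R) : 0 < eps -> 0 <= K ->
  nonneg_nondecreasing phi ->
  (\forall x \near +oo, phi x = log_profile eps x) ->
  bounded_sums (fun i => phi (Q i.+1)%:R * (K / 2 ^+ i)).
Proof.
move=> e0 K0 [phi0 phi_mono] [A [_ phiA]].
set al : R := (2 * #|F|)%:R.
have al1 : 1 <= al by rewrite ler1n; move: F0; lia.
have al0 : 0 < al by exact: lt_le_trans al1.
have ln2 : 0 < ln 2 :> R by rewrite ln_gt0 // ltr1n.
pose N := Num.bound `|A|.
pose w i : R := (i.+1%:R `^ (1 + eps))^-1.
apply: (@bounded_sums_le _ _ w N (2 * al * K / (ln 2 `^ (1 + eps)))).
- by move=> i; rewrite invr_ge0 powR_ge0.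
- by rewrite divr_ge0 ?powR_ge0 // mulr_ge0 // mulr_ge0 // ltW.
- move=> i Ni; set y := al * 2 ^+ i.+1.
  have y0 : 0 < y by rewrite mulr_gt0 // exprn_gt0.
  (* The formula for [phi] is available only beyond [A], and [N <= i] brings [expR y] there. *)
  have yA : A < expR y.
    apply: le_lt_trans (ler_norm A) _.
    apply: lt_le_trans (archi_boundP (normr_ge0 A)) _.
    apply: le_trans (expR_ge1Dx y); apply: (@le_trans _ _ (1 + i%:R)).
      by rewrite addrC natr1 ler_nat leqW.
    rewrite lerD2l; apply: (@le_trans _ _ (2 ^+ i.+1)).
      by rewrite -natrX ler_nat ltnW // (ltn_trans (ltnSn i)) // ltn_expl.
    by rewrite ler_peMl ?exprn_ge0.
  apply: (@le_trans _ _ (log_profile eps (expR y) * (K / 2 ^+ i))).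
    rewrite -phiA // ler_wpM2r ?divr_ge0 ?exprn_ge0 //.
    by apply: phi_mono; rewrite ?ler0n // place_digits_expR.
  rewrite /log_profile expRK.
  have lny : i.+1%:R * ln 2 <= ln y.
    rewrite lnM ?posrE ?exprn_gt0 // lnXn // mulr_natl lerDr.
    by rewrite ln_ge0.
  have den : (i.+1%:R * ln 2) `^ (1 + eps) <= ln y `^ (1 + eps).
    apply: ge0_ler_powR; rewrite ?nnegrE ?addr_ge0 ?(ltW e0) //.
      by rewrite mulr_ge0 // ltW.
    by apply: le_trans lny; rewrite mulr_ge0 // ltW.
  apply: (@le_trans _ _ (y / ((i.+1%:R * ln 2) `^ (1 + eps)) * (K / 2 ^+ i))).
    rewrite ler_wpM2r ?divr_ge0 ?exprn_ge0 // ler_pM2l //.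
    rewrite lef_pV2 // posrE powR_gt0 //; last exact: mulr_gt0.
    by apply: lt_le_trans lny; exact: mulr_gt0.
  rewrite powRM ?ler0n ?(ltW ln2) // /y /w exprS.
  rewrite le_eqVlt; apply/orP; left; apply/eqP; field.
  by rewrite !gt_eqF ?powR_gt0 ?exprn_gt0.
- exact: bounded_sums_riemann.
Qed.

Lemma exp_profile_sums (K : R) : (1 < #|F|)%N -> 0 <= K ->
  bounded_sums (fun i => expR (2 ^+ i * ln 2) * (K / (Q i)%:R)).
Proof.
move=> F1 K0; apply: (@bounded_sums_le _ _ (fun i => (2 ^+ i)^-1) 0%N (2 * K)).
- by move=> i; rewrite invr_ge0 exprn_ge0.
- by rewrite mulr_ge0.
- move=> i _; rewrite -natrX expRM_natl lnK ?posrE //.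
  have Q0 : 0 < (Q i)%:R :> R by rewrite ltr0n place_gt0 //; exact: digits_gt0.
  have P0 : 0 < 2 ^+ i :> R by rewrite exprn_gt0.
  rewrite mulrA ler_pdivrMr // mulrAC ler_pdivlMr //.
  have := place_digits_ge i F1; rewrite -(ler_nat R) !natrM !natrX => h.
  have := ler_wpM2l K0 h; lra.
- exact: bounded_sums_geometric.
Qed.

End Growth.

(** * The coupling and the displacement of each group measured by the other *)

Section Coupling.
Variables (R : realType) (F : finGroupType).

Local Notation T := (measurableTypeR R).
Local Notation qd := (digits F).
Local Notation Q := (place qd).
Local Notation cell := (@cell R qd).
Local Notation two := (fun _ : nat => 2%N).
Local Notation id_digit := (fun _ d : nat => d).

Let q0 := @digits_gt0 F.

(* the points at which every element of both groups acts through finitely many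
   digits *)
Definition good : set T :=
  @wandering R qd two (@bit F) `&` @wandering R qd qd id_digit.

Lemma bit_lt n k : (k < qd n)%N -> (bit F n k < 2)%N.
Proof. by move=> _; exact: bit_lt2. Qed.

Lemma good_unit : good `<=` (@unit_itv R : set T).
Proof. by move=> x [[]]. Qed.

Lemma good_tail N (x y : T) : @tail R qd N x y -> good x -> good y.
Proof.
move=> t [w1 w2]; split.
  exact: wandering_tail q0 bit_lt _ _ _ t w1.
exact: wandering_tail q0 _ _ _ _ t w2.
Qed.

Lemma measurable_good : measurable good.
Proof. by apply: measurableI; exact: (measurable_wandering _ _ q0). Qed.

Lemma good_conull : (@unit_prob R).-negligible (~` good).
Proof.
rewrite setCI; apply: negligibleU.
  exact: (wandering_conull R q0 _ (@bit_balanced F)).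
exact: (wandering_conull R q0 (@digits_gt1 F) (@rank_balanced F)).
Qed.

Let good_unit_itv (x : T) : good x -> @unit_itv R x := @good_unit x.

Lemma good_wreath_rel (x : T) (g : wreathZ F) : good x ->
  exists N l, (l < Q N)%N /\ @wreath_rel F N g (cell N x) l.
Proof.
move=> [[_ wx] _]; have [L gL] := wreath_support_exists g.
by have [N mN] := wx (2 * L).+1; exists N; exact: wreath_rel_exists gL mN.
Qed.

Lemma good_int_rel (x : T) (z : Zgroup) : good x ->
  exists N l, (l < Q N)%N /\ int_rel F N z (cell N x) l.
Proof.
move=> [_ [_ wx]]; have [N mN] := wx `|(z : int)|%N.
by exists N; exact: int_rel_exists (leqnn _) mN.
Qed.

Definition wreath_act : wreathZ F -> T -> T :=
  level_act qd (@wreath_rel F) good.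

Definition int_act : Zgroup -> T -> T := level_act qd (@int_rel F) good.

Lemma wreath_act_pmp : pmp_action (@unit_prob R) wreath_act.
Proof.
apply: level_act_pmp; [exact: q0 | exact: wreath_relS | exact: wreath_rel_inj
  | exact: wreath_rel1 | exact: wreath_relM | exact: good_unit | exact: good_tail
  | exact: measurable_good | exact: good_wreath_rel].
Qed.

Lemma int_act_pmp : pmp_action (@unit_prob R) int_act.
Proof.
apply: level_act_pmp; [exact: q0 | exact: int_relS | exact: int_rel_inj
  | exact: int_rel1 | exact: int_relM | exact: good_unit | exact: good_tail
  | exact: measurable_good | exact: good_int_rel].
Qed.

Lemma wreath_act_free g x : good x -> wreath_act g x = x -> g = 1%g.
Proof.
apply: level_act_free; [exact: q0 | exact: wreath_relS | exact: wreath_rel_inj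
  | exact: wreath_rel_free | exact: good_unit | exact: good_wreath_rel].
Qed.

Lemma int_act_free z x : good x -> int_act z x = x -> z = 1%g.
Proof.
apply: level_act_free; [exact: q0 | exact: int_relS | exact: int_rel_inj
  | exact: int_rel_free | exact: good_unit | exact: good_int_rel].
Qed.

Lemma orbit_eq x : good x -> orbit_of wreath_act x = orbit_of int_act x.
Proof.
move=> gx; rewrite /wreath_act /int_act.
rewrite (level_act_orbit q0 (@wreath_relS F) (@wreath_rel_inj F) _
  good_unit good_wreath_rel gx); last first.
  by move=> N k l kQ lQ; have [g r _] := wreath_rel_trans kQ lQ; exists g.
rewrite (level_act_orbit q0 (@int_relS F) (@int_rel_inj F) _
  good_unit good_int_rel gx) //.
by move=> N k l kQ lQ; have [z r _] := int_rel_trans kQ lQ; exists z.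
Qed.

Lemma ae_good (P : T -> Prop) : (forall x, good x -> P x) ->
  {ae (@unit_prob R), forall x, P x}.
Proof. by move=> gP; apply: negligibleS good_conull => x nP /gP. Qed.

Lemma coupling_oe : oe_coupling (@unit_prob R) wreath_act int_act.
Proof.
split; first exact: standard_borel_real.
- split; first exact: wreath_act_pmp.
  by apply: ae_good => x gx g g1 /(wreath_act_free gx).
- split; first exact: int_act_pmp.
  by apply: ae_good => x gx g g1 /(int_act_free gx).
- by apply: ae_good => x gx; exact: orbit_eq.
Qed.

(** The image has the tail of [x] beyond level [N], so an integer of size at most [Q N] reaches it
    too, by moving between the two cells. *)
Lemma wreath_act_dist (S : seq Zgroup) C :
  (forall z : Zgroup, word_length S z <= C * `|(z : int)|)%N ->
  forall (x : T) L g N, good x -> wreath_support L g ->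
  margin qd two (@bit F) (2 * L).+1 N (cell N x) ->
  (orbit_dist int_act S x (wreath_act g x) <= C * Q N)%N.
Proof.
move=> SC x L g N gx gL mN; have [l [lQ r]] := wreath_rel_exists gL mN.
have [t lE] := level_act_exists q0 (@wreath_relS F) (@wreath_rel_inj F)
  good_unit gx lQ r.
have xQ := cell_lt q0 N (good_unit_itv gx).
have [z rz zQ] := int_rel_trans xQ lQ.
have <- : int_act z x = wreath_act g x.
  by apply: (level_actP q0 (@int_relS F) (@int_rel_inj F) gx t); rewrite lE.
apply: leq_trans (orbit_dist_le _ _ _ _) _; apply: leq_trans (SC z) _.
by rewrite leq_mul2l zQ orbT.
Qed.

(** Any two tiles of level [N] are related by an element supported within [2 ^ N], whose word length
    is [O(2 ^ N)]. *)
Lemma int_act_dist (S : seq (wreathZ F)) C :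
  (forall L g, (0 < L)%N -> wreath_support L g -> word_length S g <= C * L)%N ->
  forall (x : T) (z : Zgroup) N, good x ->
  margin qd qd id_digit `|(z : int)|%N N (cell N x) ->
  (orbit_dist wreath_act S x (int_act z x) <= C * 2 ^ N)%N.
Proof.
move=> SC x z N gx mN; have [l [lQ r]] := int_rel_exists (leqnn _) mN.
have [t lE] := level_act_exists q0 (@int_relS F) (@int_rel_inj F)
  good_unit gx lQ r.
have xQ := cell_lt q0 N (good_unit_itv gx).
have [g rg gN] := wreath_rel_trans xQ lQ.
have <- : wreath_act g x = int_act z x.
  by apply: (level_actP q0 (@wreath_relS F) (@wreath_rel_inj F) gx t); rewrite lE.
apply: leq_trans (orbit_dist_le _ _ _ _) _; apply: SC gN.
by rewrite expn_gt0.
Qed.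

Lemma orbit_dist_refl (G : groupType) (act : G -> T -> T) (S : seq G) (x : T) :
  is_left_action act -> orbit_dist act S x x = 0%N.
Proof.
move=> [a1 _]; apply/eqP; rewrite -leqn0 -(word_length1 S).
by have := orbit_dist_le S act x 1%g; rewrite a1.
Qed.

(** A good point is charged at its first level with margin, so it lies in the failure sets of all
    earlier levels, of measure at most [2 * K / place r i]. Other points are charged at level 0. *)
Lemma integral_margin (r : nat -> nat) (e : nat -> nat -> nat) (K : nat)
    (h : T -> R) (B : nat -> R) :
  (forall n, (1 < r n)%N) ->
  (forall n (h : nat -> nat),
    ((\sum_(d < qd n) h (e n d)) * r n = qd n * \sum_(i < r n) h i)%N) ->
  (forall n, 0 <= B n) -> (forall x, 0 <= h x) ->
  (forall x, ~ good x -> h x <= B 0%N) ->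
  (forall x, good x -> exists N, margin qd r e K N (cell N x)) ->
  (forall x N, good x -> margin qd r e K N (cell N x) -> h x <= B N) ->
  bounded_sums (fun i => B i.+1 * ((2 * K)%:R / (place r i)%:R)) ->
  (\int[(@unit_prob R)]_x (h x)%:E < +oo)%E.
Proof.
move=> r2 bal B0 h0 hbad hex hgood [A sumA].
apply: (integral_layers (B := B) (p := fun i => (2 * K)%:R / (place r i)%:R)
  (M := fun n => level_set qd n (fun k => ~~ margin qd r e K n k)) (K := A)) => //.
- by move=> n; exact: measurable_level_set.
- by move=> n; exact: unit_prob_not_margin.
move=> x; have [gx|ngx] := pselect (good x); last by exists 0%N => //; exact: hbad.
case: (ex_minnP (hex x gx)) => N mN minN; exists N; first exact: hgood.
move=> n nN; split; first exact: good_unit_itv.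
by apply/negP => /minN; rewrite leqNgt nN.
Qed.

Lemma wreath_displacement (S : seq Zgroup) (eps : R) (phi : R -> R) :
  finite_symmetric_generating S -> 0 < eps -> nonneg_nondecreasing phi ->
  (\forall x \near +oo, phi x = log_profile eps x) ->
  displacement_integrable (@unit_prob R) wreath_act int_act S phi.
Proof.
move=> genS e0 phi_mono phi_log g.
have [C SC] := word_length_int genS; have [L gL] := wreath_support_exists g.
have [phi0 phile] := phi_mono.
have c0 : 0 < C.+1%:R :> R by rewrite ltr0n.
(* This scale absorbs the constant of the generating set and is positive even if [C] is 0. *)
exists C.+1%:R => //.
apply: (@integral_margin two (@bit F) (2 * L).+1 _ (fun N => phi (Q N)%:R)) => //.
- by move=> n h; exact: bit_balanced.
- by move=> n; apply: phi0.
- by move=> x; apply: phi0; rewrite divr_ge0.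
- move=> x ngx; rewrite /wreath_act level_act_out // orbit_dist_refl ?mul0r.
    exact: phile.
  by have [] := int_act_pmp.
- by move=> x [[_ wx] _]; exact: wx.
- move=> x N gx mN; apply: phile; first by rewrite divr_ge0.
  rewrite ler_pdivrMr // -natrM ler_nat mulnC.
  apply: leq_trans (wreath_act_dist SC gx gL mN) _.
  by rewrite leq_mul2r leqnSn orbT.
- have [A sumA] := log_profile_sums F e0 (ler0n R (2 * (2 * L).+1)) phi_mono phi_log.
  by exists A => n; under eq_bigr do rewrite place2 natrX; exact: sumA.
Qed.

Lemma int_displacement (S : seq (wreathZ F)) : (1 < #|F|)%N ->
  finite_symmetric_generating S ->
  displacement_integrable (@unit_prob R) int_act wreath_act S expR.
Proof.
move=> F1 genS z; have [C SC] := word_length_wreath genS.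
have ln2 : 0 < ln 2 :> R by rewrite ln_gt0 // ltr1n.
(* The layer bounded at level [i.+1] is weighted by the failure at level [i]; this [c] gives
   [C * 2 ^ i.+1 / c <= 2 ^ i * ln 2], as [exp_profile_sums] requires. *)
pose c : R := (2 * C.+1)%:R / ln 2.
have c0 : 0 < c by rewrite divr_gt0 // ltr0n.
exists c => //.
apply: (@integral_margin qd id_digit `|(z : int)|%N _
  (fun N => expR ((C * 2 ^ N)%N%:R / c))) => //.
- exact: digits_gt1.
- by move=> n h; exact: rank_balanced.
- move=> x ngx; rewrite /int_act level_act_out // orbit_dist_refl.
    by rewrite ler_expR ler_pM2r ?invr_gt0 // ler_nat.
  by have [] := wreath_act_pmp.
- by move=> x [_ [_ wx]]; exact: wx.
- move=> x N gx mN; rewrite ler_expR ler_pM2r ?invr_gt0 // ler_nat.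
  exact: int_act_dist SC _ _ _ gx mN.
- have [A sumA] := exp_profile_sums F1 (ler0n R (2 * `|(z : int)|%N)).
  exists A => n; apply: le_trans (sumA n); apply: ler_sum => i _.
  rewrite ler_wpM2r ?divr_ge0 // ler_expR /c invf_div mulrA.
  rewrite ler_pdivrMr ?ltr0n // !natrM natrX exprS -[C.+1%:R]natr1.
  have := mulr_ge0 (exprn_ge0 i (ler0n R 2)) (ltW ln2).
  move: (2 ^+ i) (ln 2) (C%:R) => *; lra.
Qed.

End Coupling.

(* If F is trivial then Q_N = 2^N and the exponential bound fails for the coupling
   above, but then F wr Z = Z can be coupled with Z through a single action. *)
Section TrivialLamps.
Variables (R : realType) (F : finGroupType).
Hypothesis F1 : (#|F| <= 1)%N.

Local Notation T := (measurableTypeR R).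

Definition shift_act (g : wreathZ F) : T -> T := @int_act R F (wreath_pos g).

Lemma wreath_pos_inj (g : wreathZ F) : wreath_pos g = 0 -> g = 1%g.
Proof.
move=> g0; apply: wreathZ_eq => // i.
by apply: (card_le1_eqP F1).
Qed.

Lemma shift_oe : oe_coupling (@unit_prob R) shift_act (@int_act R F).
Proof.
have [[act_one actM] mact act_mp] := @int_act_pmp R F.
split; first exact: standard_borel_real.
- split; first split.
  + by split=> [x|g h x]; [exact: act_one | exact: actM].
  + by move=> g; exact: mact.
  + by move=> g; exact: act_mp.
  apply: (@ae_good R F) => x gx g g1 /(int_act_free gx) g0.
  by apply: g1; apply: wreath_pos_inj.
- split; first exact: int_act_pmp.
  by apply: (@ae_good R F) => x gx z z1 /(int_act_free gx).
- apply: (@ae_good R F) => x _; apply/seteqP; split => [_ [g _ <-]|_ [z _ <-]].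
    by exists (wreath_pos g).
  by exists (WreathZ (lamps1 F) z).
Qed.

Lemma integral_bounded (h : T -> R) (B : R) :
  (forall x, 0 <= h x) -> (forall x, h x <= B) ->
  (\int[(@unit_prob R)]_x (h x)%:E < +oo)%E.
Proof.
move=> h0 hB; apply: (integral_layers (B := fun=> B) (p := fun=> 0)
  (M := fun=> set0) (K := 0)) => //.
- by move=> n; exact: le_trans (h0 0) (hB 0).
- by move=> n; rewrite measure0.
- by move=> x; exists 0%N.
- by move=> n; rewrite big1 // => i _; rewrite mulr0.
Qed.

(** Each element acts as one fixed element of the other group, so its displacement is bounded by the
    word length of that element. *)
Lemma shift_integrable (SG : seq (wreathZ F)) (SL : seq Zgroup) (phi psi : R -> R) :
  nonneg_nondecreasing phi -> nonneg_nondecreasing psi ->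
  coupling_integrable (@unit_prob R) shift_act (@int_act R F) SG SL phi psi.
Proof.
move=> [phi0 phile] [psi0 psile]; split=> g; exists 1 => //.
  apply: (@integral_bounded _ (phi (word_length SL (wreath_pos g : Zgroup))%:R)) => x.
    by apply: phi0; rewrite divr1.
  apply: phile; rewrite divr1 // ler_nat; exact: orbit_dist_le.
pose w : wreathZ F := WreathZ (lamps1 F) g.
apply: (@integral_bounded _ (psi (word_length SG w)%:R)) => x.
  by apply: psi0; rewrite divr1.
by apply: psile; rewrite divr1 // ler_nat; exact: (orbit_dist_le _ shift_act x w).
Qed.

End TrivialLamps.

Theorem theorem9 (R : realType) (F : finGroupType) :
  exists (d : measure_display) (T : measurableType d) (mu : probability T R)
         (a : wreathZ F -> T -> T) (b : Zgroup -> T -> T),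
    oe_coupling mu a b /\
    forall (SG : seq (wreathZ F)) (SL : seq Zgroup),
      finite_symmetric_generating SG -> finite_symmetric_generating SL ->
      forall (eps : R) (phi : R -> R),
        0 < eps -> nonneg_nondecreasing phi ->
        (\forall x \near +oo, phi x = log_profile eps x) ->
        coupling_integrable mu a b SG SL phi expR.
Proof.
have [F1|F1] := leqP #|F| 1.
  exists _, (measurableTypeR R), (@unit_prob R), (@shift_act R F), (@int_act R F).
  split; first exact: shift_oe.
  move=> SG SL _ _ eps phi _ phi_mono _; apply: shift_integrable => //.
  by split=> [x _|x y _ xy]; rewrite ?expR_ge0 ?ler_expR.
exists _, (measurableTypeR R), (@unit_prob R), (@wreath_act R F), (@int_act R F).
split; first exact: coupling_oe.
move=> SG SL genG genL eps phi eps0 phi_mono phi_log; split.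
  exact: wreath_displacement phi_log.
exact: int_displacement.
Qed.
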